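(* Let $n\ge 2$, let $F_1,\dots,F_n:\mathbf R\to[0,1]$ be one-dimensional cumulative distribution functions (cdf's), and let $\xi_1,\dots,\xi_n$ be independent random variables with $P(\xi_k\le x)=F_k(x)$ for all $x\in\mathbf R$, $k=1,\dots,n$. A function $F:\mathbf R^n\to[0,1]$ is a joint cdf with one-dimensional marginal cdf's $F_1,\dots,F_n$ that is absolutely continuous with respect to the product of the marginal cdf's $\prod_{k=1}^nF_k(x_k)$ if and only if there exist Borel measurable functions $g_{i_1,\dots,i_c}:\mathbf R^c\to\mathbf R$, $1\le i_1<\dots<i_c\le n$, $c=2,\dots,n$, such that (A1) $E|g_{i_1,\dots,i_c}(\xi_{i_1},\dots,\xi_{i_c})|<\infty$ for all $1\le i_1<\dots<i_c\le n$, $c=2,\dots,n$; (A2) for all $1\le i_1<\dots<i_c\le n$, $c=2,\dots,n$, and $k=1,\dots,c$, $$E\big(g_{i_1,\dots,i_c}(\xi_{i_1},\dots,\xi_{i_c})\,\big|\,\xi_{i_1},\dots,\xi_{i_{k-1}},\xi_{i_{k+1}},\dots,\xi_{i_c}\big)=\int_{-\infty}^{\infty}g_{i_1,\dots,i_c}(\xi_{i_1},\dots,\xi_{i_{k-1}},x,\xi_{i_{k+1}},\dots,\xi_{i_c})\,dF_{i_k}(x)=0\quad\text{(a.s.)};$$ (A3) $U_n(\xi_1,\dots,\xi_n)\ge-1$ (a.s.), where $U_n(x_1,\dots,x_n)=\sum_{c=2}^n\sum_{1\le i_1<\dots<i_c\le n}g_{i_1,\dots,i_c}(x_{i_1},\dots,x_{i_c})$;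 and such that for all $(x_1,\dots,x_n)\in\mathbf R^n$ $$F(x_1,\dots,x_n)=\int_{-\infty}^{x_1}\cdots\int_{-\infty}^{x_n}\big(1+U_n(t_1,\dots,t_n)\big)\prod_{i=1}^ndF_i(t_i).$$ Moreover, in this case $g_{i_1,\dots,i_c}(\xi_{i_1},\dots,\xi_{i_c})=f_{i_1,\dots,i_c}(\xi_{i_1},\dots,\xi_{i_c})$ (a.s.) for all $1\le i_1<\dots<i_c\le n$, $c=2,\dots,n$, where $$f_{i_1,\dots,i_c}(x_{i_1},\dots,x_{i_c})=\sum_{k=2}^c(-1)^{c-k}\sum_{j_1<\dots<j_k\in\{i_1,\dots,i_c\}}\left(\frac{dF(x_{j_1},\dots,x_{j_k})}{dF_{j_1}\cdots dF_{j_k}}-1\right).$$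
   Context: Cdf's are taken right-continuous. A joint cdf $F$ on $\mathbf R^n$ with one-dimensional marginals $F_1,\dots,F_n$ is called absolutely continuous with respect to the product of the marginal cdf's if there is a Borel function $G:\mathbf R^n\to[0,\infty)$ with $F(x_1,\dots,x_n)=\int_{-\infty}^{x_1}\cdots\int_{-\infty}^{x_n}G(t_1,\dots,t_n)\,dF_1(t_1)\cdots dF_n(t_n)$ for all $x_1,\dots,x_n$; one writes $G=\frac{dF}{dF_1\cdots dF_n}$. For $1\le j_1<\dots<j_k\le n$, $F(x_{j_1},\dots,x_{j_k})$ denotes the $k$-dimensional marginal cdf of $F$ in the coordinates $j_1,\dots,j_k$, and $\frac{dF(x_{j_1},\dots,x_{j_k})}{dF_{j_1}\cdots dF_{j_k}}$ denotes its density with respect to $dF_{j_1}\cdots dF_{j_k}$, taken to be $1$ if $(x_{j_1},\dots,x_{j_k})$ is not in the support of $dF_{j_1}\cdots dF_{j_k}$. The inner sum in the formula for $f_{i_1,\dots,i_c}$ is over all $k$-element subsets $\{j_1<\dots<j_k\}$ of $\{i_1,\dots,i_c\}$. *)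

(* Defs.v *)
From HB Require Import structures.
From mathcomp Require Import all_boot all_order all_algebra.
From mathcomp Require Import all_classical all_reals all_analysis.

Set Implicit Arguments.
Unset Strict Implicit.
Unset Printing Implicit Defensive.

Import Order.TTheory GRing.Theory Num.Theory.
Import numFieldNormedType.Exports.

Local Open Scope classical_set_scope.
Local Open Scope ring_scope.

(* One-dimensional cdf's: nondecreasing, right-continuous, with limits 0 at -oo
   and 1 at +oo. *)
Notation cdfType R := (cumulativeBounded (0 : R) (1 : R)).

(* Points of R^n are n-tuples; a subset A = {i_1 < ... < i_c} of the indices
   stands for the multi-index (i_1, ..., i_c), since enum_val : 'I_#|A| -> 'I_n
   enumerates A increasingly.  So coords A x = (x_{i_1}, ..., x_{i_c}). *)
Definition coords (R : realType) (n : nat) (A : {set 'I_n}) (x : n.-tuple R) :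
    #|A|.-tuple R :=
  [tuple tnth x (enum_val j) | j < #|A|].

Definition subfamily (R : realType) (n : nat) (F_ : 'I_n -> cdfType R)
    (A : {set 'I_n}) : 'I_#|A| -> cdfType R :=
  fun j => F_ (enum_val j).

Definition subst_coord (R : realType) (n : nat) (k : 'I_n) (t : R)
    (x : n.-tuple R) : n.-tuple R :=
  [tuple if i == k then t else tnth x i | i < n].

(* \int_(D_1) ... \int_(D_n) f(t_1, ..., t_n) dF_n(t_n) ... dF_1(t_1), with the
   integral in the first variable outermost. *)
Fixpoint iter_int (R : realType) (n : nat) :
    ('I_n -> cdfType R) -> ('I_n -> set R) -> (n.-tuple R -> \bar R) -> \bar R :=
  match n with
  | 0 => fun _ _ f => f [tuple]
  | m.+1 => fun F_ D f =>
      (\int[lebesgue_stieltjes_measure (F_ ord0)]_(t in D ord0)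
         iter_int (fun i : 'I_m => F_ (lift ord0 i))
           (fun i : 'I_m => D (lift ord0 i))
           (fun y : m.-tuple R => f [tuple of t :: y]))%E
  end.

Definition cdf_int (R : realType) (n : nat) (F_ : 'I_n -> cdfType R)
    (G : n.-tuple R -> R) (x : n.-tuple R) : \bar R :=
  iter_int F_ (fun i => `]-oo, tnth x i]%classic) (EFin \o G).

Definition is_joint_cdf (R : realType) (n : nat) (F : n.-tuple R -> R) : Prop :=
  exists Q : probability (n.-tuple R) R,
    forall x, (F x)%:E = Q [set y | forall i, tnth y i <= tnth x i].

Definition has_marginals (R : realType) (n : nat) (F_ : 'I_n -> cdfType R)
    (F : n.-tuple R -> R) : Prop :=
  forall (k : 'I_n) (r : R),
    F [tuple if i == k then r else t | i < n] @[t --> +oo] --> F_ k r.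

Definition is_density (R : realType) (n : nat) (F_ : 'I_n -> cdfType R)
    (F : n.-tuple R -> R) (G : n.-tuple R -> R) : Prop :=
  [/\ measurable_fun [set: n.-tuple R] G,
      forall x, 0 <= G x
    & forall x, (F x)%:E = cdf_int F_ G x].

Definition abs_continuous (R : realType) (n : nat) (F_ : 'I_n -> cdfType R)
    (F : n.-tuple R -> R) : Prop :=
  exists G : n.-tuple R -> R, is_density F_ F G.

(* The point of R^n with y in the coordinates of J and t elsewhere: for i not in
   J, index i (enum J) = #|J| is out of bounds and nth returns its default t. *)
Definition fill (R : realType) (n : nat) (J : {set 'I_n}) (y : #|J|.-tuple R)
    (t : R) : n.-tuple R :=
  [tuple nth t y (index i (enum J)) | i < n].

Definition marginal_cdf (R : realType) (n : nat) (F : n.-tuple R -> R)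
    (J : {set 'I_n}) (y : #|J|.-tuple R) : R :=
  lim (F (fill y t) @[t --> +oo]).

(* The support of the product measure dF_1 ... dF_n: all open cubes around x
   have positive measure. *)
Definition prod_support (R : realType) (n : nat) (F_ : 'I_n -> cdfType R) :
    set (n.-tuple R) :=
  [set x | forall e : R, 0 < e ->
     (0 < iter_int F_ (fun i => `](tnth x i - e)%R, (tnth x i + e)%R[%classic) (cst 1))%E].

Definition is_marginal_density (R : realType) (n : nat)
    (F_ : 'I_n -> cdfType R) (F : n.-tuple R -> R) (J : {set 'I_n})
    (G : #|J|.-tuple R -> R) : Prop :=
  is_density (subfamily F_ (A := J)) (marginal_cdf F (J := J)) G /\
  forall y, ~ prod_support (subfamily F_ (A := J)) y -> G y = 1.

Section random_variables.
Context d (T : measurableType d) (R : realType) (P : probability T R).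

Definition mutually_independent (n : nat) (xi : 'I_n -> {RV P >-> R}) : Prop :=
  forall (J : {set 'I_n}) (B : 'I_n -> set R),
    (forall i, measurable (B i)) ->
    P (\bigcap_(i in [set i | i \in J]) (xi i @^-1` B i)) =
    (\prod_(i in J) P (xi i @^-1` B i))%E.

Definition rvec (n : nat) (xi : 'I_n -> {RV P >-> R}) (w : T) : n.-tuple R :=
  [tuple xi i w | i < n].

Definition sigma_rv (n : nat) (xi : 'I_n -> {RV P >-> R}) (J : {set 'I_n}) :
    set (set T) :=
  <<s \bigcup_(j in [set j | j \in J])
        preimage_set_system [set: T] (xi j) measurable >>.

(* Z is a version of E(X | S). *)
Definition is_cond_exp (X : T -> R) (S : set (set T)) (Z : T -> R) : Prop :=
  [/\ forall B : set R, measurable B -> S (Z @^-1` B),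
      P.-integrable [set: T] (EFin \o Z)
    & forall A, S A ->
        (\int[P]_(w in A) (Z w)%:E = \int[P]_(w in A) (X w)%:E)%E].

End random_variables.

Section decomposition.
Context d (T : measurableType d) (R : realType) (P : probability T R) (n : nat).
Variables (F_ : 'I_n -> cdfType R) (xi : 'I_n -> {RV P >-> R}).
Variable g : forall A : {set 'I_n}, #|A|.-tuple R -> R.

Definition U_sum (x : n.-tuple R) : R :=
  \sum_(2 <= c < n.+1) \sum_(A : {set 'I_n} | #|A| == c) g (coords A x).

Definition borel_family : Prop :=
  forall A : {set 'I_n}, (2 <= #|A|)%N ->
    measurable_fun [set: #|A|.-tuple R] (@g A).

Definition integrable_family : Prop :=
  forall A : {set 'I_n}, (2 <= #|A|)%N ->
    ('E_P[fun w => `|g (coords A (rvec xi w))|%R] < +oo)%E.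

(* The value at x of the integral of g_A in its argument of index k. *)
Definition partial_int (A : {set 'I_n}) (k : 'I_n) (x : n.-tuple R) : \bar R :=
  (\int[lebesgue_stieltjes_measure (F_ k)]_t
     (g (coords A (subst_coord k t x)))%:E)%E.

Definition degenerate_family : Prop :=
  forall (A : {set 'I_n}) (k : 'I_n), (2 <= #|A|)%N -> k \in A ->
    exists Z : T -> R,
      [/\ is_cond_exp P (fun w => g (coords A (rvec xi w)))
            (sigma_rv xi (A :\ k)) Z,
          {ae P, forall w, (Z w)%:E = partial_int A k (rvec xi w)}
        & {ae P, forall w, partial_int A k (rvec xi w) = 0%E}].

Definition bounded_below_family : Prop :=
  {ae P, forall w, -1 <= U_sum (rvec xi w)}.

Definition represents (F : n.-tuple R -> R) : Prop :=
  [/\ borel_family, integrable_family, degenerate_family, bounded_below_family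
    & forall x, (F x)%:E = cdf_int F_ (fun t => 1 + U_sum t) x].

End decomposition.

(* f_A at x, which depends on x only through coords A x; dens J plays the role
   of the density of the J-marginal of F. *)
Definition f_incl_excl (R : realType) (n : nat)
    (dens : forall J : {set 'I_n}, #|J|.-tuple R -> R) (A : {set 'I_n})
    (x : n.-tuple R) : R :=
  \sum_(2 <= k < #|A|.+1) (-1) ^+ (#|A| - k) *
    \sum_(J : {set 'I_n} | (J \subset A) && (#|J| == k)) (dens J (coords J x) - 1).

(* Main.v *)
Require Import Defs.
From HB Require Import structures.
From mathcomp Require Import all_boot all_order all_algebra.
From mathcomp Require Import all_classical all_reals all_analysis.
From mathcomp Require Import measurable_realfun.

Set Implicit Arguments.
Unset Strict Implicit.
Unset Printing Implicit Defensive.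

Import Order.TTheory GRing.Theory Num.Theory.
Import numFieldNormedType.Exports.

Local Open Scope classical_set_scope.
Local Open Scope ring_scope.

(** The product law mu of the independent variables is invariant under
    resampling coordinates.  Averaging a density G over the coordinates outside J
    therefore gives the density G_J of the J-marginal, and integrating G_J over
    one coordinate k in J gives G_(J \ k).  In the alternating sums
    g_A = sum_(J c A) (-1)^|A \ J| G_J the terms J and J + {k} hence cancel once
    the coordinate k in A is integrated out, which is (A2), while Moebius
    inversion gives G = sum_A g_A; as the one-dimensional marginals are the F_k,
    G_J = 1 a.e. for |J| <= 1, so that sum is 1 + U_n.
    Conversely, (A2) makes g_A orthogonal to every event that does not involve
    some coordinate of A, so the J-marginal of 1 + U_n has density
    sum_(A c J) g_A; a density is determined a.e. by its cdf, and Moebius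
    inversion recovers g_A from the marginal densities. *)

(** Iterated integrals, random variables and coordinate vectors of varying length are all brought
    back to the one law [prodm F_] on tuples. The device is [has_law]: a map need only give boxes
    the right mass, and then integrals, integrability and null sets transfer along it. Projection to
    the coordinates in J, replacement of one coordinate by a fresh variable, splicing of two
    independent points, and the random vector itself are such maps; the Fubini arguments then become
    one transfer followed by Fubini for two factors. Two facts that hold only almost everywhere
    shape the rest. Averages of a density may be infinite on a null set, so the real-valued
    components take [fine] of them, and the cancellation for (A2) is done at points where all
    averages are finite. And 1 + U_n may be negative on a null set, so the density exhibited for F
    is its positive part. Integrability of a given density comes from F <= 1. *)

Local Notation ls := lebesgue_stieltjes_measure.

(** * Boxes and product laws on tuples *)

Definition rect (R : realType) (m : nat) (B : 'I_m -> set R) : set (m.-tuple R) :=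
  [set x | forall i, B i (tnth x i)].

(** Closed lower orthants: the mass of [box b] is the joint cdf at b. They form a pi-system
    generating the Borel sets, which is why everything below is tested on them. *)
Definition box (R : realType) (m : nat) (b : m.-tuple R) : set (m.-tuple R) :=
  rect (fun i => `]-oo, tnth b i]%classic).

Section tuple_boxes.
Context (R : realType).

Lemma measurable_rect m (B : 'I_m -> set R) :
  (forall i, measurable (B i)) -> measurable (rect B).
Proof.
move=> mB.
rewrite (_ : rect B = \bigcap_(i in [set: 'I_m]) ((@tnth m R ^~ i) @^-1` B i)).
  apply: fin_bigcap_measurable => // i _.
  by rewrite -[X in measurable X]setTI; exact: measurable_tnth.
by apply/seteqP; split => [x Bx i _|x Bx i]; exact: Bx.
Qed.

Lemma measurable_box m (b : m.-tuple R) : measurable (box b).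
Proof. by apply: measurable_rect => i; exact: measurable_itv. Qed.

Lemma boxI m (b c : m.-tuple R) :
  box b `&` box c = box [tuple Num.min (tnth b i) (tnth c i) | i < m].
Proof.
apply/seteqP; split => x.
  move=> [bx cx] i; have := bx i; have := cx i.
  by rewrite /= !in_itv/= tnth_mktuple le_min => -> ->.
move=> bx; split=> i; have := bx i; rewrite /= !in_itv/= tnth_mktuple le_min.
  by case/andP.
by case/andP.
Qed.

Lemma bigcup_box_nat m (J : {set 'I_m}) (b : m.-tuple R) :
  \bigcup_k box [tuple if i \in J then tnth b i else k%:R | i < m] =
  [set x | forall i, i \in J -> tnth x i <= tnth b i].
Proof.
apply/seteqP; split => [x [k _ xk] i iJ|x xb].
  by have := xk i; rewrite /= in_itv/= tnth_mktuple iJ.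
(* One integer must dominate every coordinate of x; a sum of naturals bounds each of its terms. *)
exists (\sum_(i < m) Num.truncn (tnth x i)).+1%N => // i /=.
rewrite in_itv/= tnth_mktuple; case: ifPn => iJ; first exact: xb.
rewrite (le_trans (ltW (truncnS_gt _)))// ler_nat ltnS.
by rewrite (bigD1 i)//= leq_addr.
Qed.

(** The Borel structure on tuples is generated by the projections, and that of the line by the
    half-lines []x, +oo[]. The complement of the preimage of such a half-line under a projection is
    a half-space, and letting the bounds on the other coordinates grow writes it as a countable
    union of boxes. *)
Lemma measurable_tuple_box m :
  @measurable _ (m.-tuple R) = <<s range (@box R m) >>.
Proof.
apply/seteqP; split; last first.
  apply: smallest_sub; first exact: sigma_algebra_measurable.
  by move=> _ [b _ <-]; exact: measurable_box.
apply: smallest_sub; first exact: smallest_sigma_algebra.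
rewrite -bigcup_seq => _ [i /= _ [B mB <-]].
rewrite setTI.
have {}mB : <<s @RGenOInfty.G R >> B.
  by have := @RGenOInfty.measurableE R; rewrite /measurable/= => <-.
pose G := [set B : set R | <<s range (@box R m) >> ((@tnth m R ^~ i) @^-1` B)].
suff : <<s @RGenOInfty.G R >> `<=` G by exact.
apply: smallest_sub.
  split => /=.
  - by rewrite /G /= preimage_set0; exact: sigma_algebra0.
  - move=> A GA; rewrite /G /= setTD preimage_setC.
    exact: sigma_algebraC.
  - move=> A GA; rewrite /G/= preimage_bigcup.
    exact: sigma_algebra_bigcup.
move=> _ [x ->]; rewrite /G/=.
rewrite -[X in _ X]setCK preimage_setC setCitvr.
apply: sigma_algebraC.
rewrite (_ : _ @^-1` _ = \bigcup_k
    box [tuple if j \in [set i]%SET then tnth [tuple x | j < m] j else k%:R | j < m]).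
  by apply: sigma_algebra_bigcup => k; apply: sub_gen_smallest; eexists.
rewrite bigcup_box_nat; apply/seteqP; split => y /=; rewrite in_itv/=.
  by move=> yx j /set1P ->; rewrite tnth_mktuple.
by move=> /(_ i (set11 _)); rewrite tnth_mktuple.
Qed.

End tuple_boxes.

Definition tcons (R : realType) m (ty : measurableTypeR R * m.-tuple R) :
    m.+1.-tuple R :=
  [tuple of ty.1 :: ty.2].

Lemma measurable_tcons (R : realType) m : measurable_fun setT (@tcons R m).
Proof. by apply: (@measurable_cons _ _ _ _ fst m snd). Qed.

HB.instance Definition _ (R : realType) m :=
  isMeasurableFun.Build _ _ _ _ (@tcons R m) (@measurable_tcons R m).

(** The recursion peels off the first coordinate exactly as [iter_int] does, so one Fubini step for
    that coordinate is the induction step when the two are compared. *)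
Fixpoint prodm (R : realType) (m : nat) :
    ('I_m -> cdfType R) -> probability (m.-tuple R) R :=
  match m with
  | 0 => fun _ => [the probability _ _ of dirac ([tuple] : 0.-tuple R)]
  | m'.+1 => fun F_ => [the probability _ _ of
      distribution
        [the probability _ _ of
          (ls (F_ ord0) \x prodm (fun i => F_ (lift ord0 i)))%E]
        (@tcons R m')]
  end.

Lemma tcons_rect (R : realType) m (B : 'I_m.+1 -> set R) :
  @tcons R m @^-1` rect B = B ord0 `*` rect (fun i => B (lift ord0 i)).
Proof.
apply/seteqP; split => -[t y] /=.
  move=> tyB; split; first by have := tyB ord0; rewrite /tcons tnth0.
  by move=> i; have := tyB (lift ord0 i); rewrite /tcons tnthS.
move=> [tB yB] i; rewrite /tcons/=.
case: (unliftP ord0 i) => [j ->|->]; [rewrite tnthS; exact: yB|by rewrite tnth0].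
Qed.

Lemma prodm_rect (R : realType) m (F_ : 'I_m -> cdfType R) (B : 'I_m -> set R) :
  (forall i, measurable (B i)) ->
  prodm F_ (rect B) = (\prod_(i < m) ls (F_ i) (B i))%E.
Proof.
elim: m F_ B => [|m IH] F_ B mB.
  by rewrite big_ord0 /= diracE mem_set// => -[].
rewrite big_ord_recl /= /distribution /pushforward tcons_rect.
rewrite product_measure1E; [|exact: mB|exact: measurable_rect].
by congr (_ * _)%E; exact: IH.
Qed.

Lemma ls_itvNy (R : realType) (f : cdfType R) (x : R) :
  ls f `]-oo, x]%classic = (f x)%:E.
Proof. exact: (cdf_lebesgue_stieltjes_id f x). Qed.

Definition has_law (R : realType) m (F_ : 'I_m -> cdfType R) d
    (X : measurableType d) (nu : probability X R) (phi : X -> m.-tuple R) :=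
  measurable_fun setT phi /\
  forall b, nu (phi @^-1` box b) = prodm F_ (box b).

Section change_of_variables.
Context (R : realType) (m : nat) (F_ : 'I_m -> cdfType R) d
  (X : measurableType d) (nu : probability X R) (phi : X -> m.-tuple R).
Hypothesis phiF : has_law F_ nu phi.
Local Open Scope ereal_scope.

Let mphi_mixin := isMeasurableFun.Build _ _ _ _ _ (proj1 phiF).
Let mphi : {mfun _ >-> _} := HB.pack phi mphi_mixin.

(** Uniqueness of measures: boxes are stable under intersection, generate the Borel sets, and cover
    the space by a sequence of sets of finite mass. *)
Lemma has_lawE A : measurable A -> nu (phi @^-1` A) = prodm F_ A.
Proof.
move=> mA.
(* The covering sequence consists of the boxes with all bounds equal to k. It is written with a
   vacuous test on the empty index set so that [bigcup_box_nat] applies verbatim. *)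
have := @measure_unique _ R (m.-tuple R) (range (@box R m))
  (fun k => box [tuple if i \in finset.set0 then tnth [tuple 0%R | i < m] i else k%:R%R | i < m])
  (measurable_tuple_box R m) _ _ _ (distribution nu mphi) (prodm F_) _ _ A mA.
apply.
- by move=> _ _ [b _ <-] [c _ <-]; rewrite boxI; eexists.
- by move=> k; eexists.
- rewrite bigcup_box_nat; apply/seteqP; split => // x _ i; by rewrite inE.
- by move=> _ [b _ <-]; exact: (proj2 phiF).
- by move=> k; rewrite (le_lt_trans (probability_le1 _ _)) ?ltry//; exact: measurable_box.
Qed.

Lemma ge0_integral_law (f : m.-tuple R -> \bar R) :
  measurable_fun setT f -> (forall x, 0 <= f x) ->
  \int[prodm F_]_x f x = \int[nu]_w f (phi w).
Proof.
move=> mf f0; rewrite -(ge0_integral_distribution mphi mf f0).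
by apply: eq_measure_integral => A mA _; exact/esym/has_lawE.
Qed.

Lemma integrable_law (f : m.-tuple R -> \bar R) :
  (prodm F_).-integrable setT f -> nu.-integrable setT (f \o phi).
Proof.
move=> /integrableP[mf fi]; apply/integrableP; split.
  by apply: measurableT_comp => //; exact: (proj1 phiF).
rewrite -(@ge0_integral_law (abse \o f))//.
  exact: measurableT_comp.
by move=> x; exact: abse_ge0.
Qed.

Lemma integral_law (f : m.-tuple R -> \bar R) :
  (prodm F_).-integrable setT f ->
  \int[prodm F_]_x f x = \int[nu]_w f (phi w).
Proof.
move=> fi; rewrite -(@integral_distribution _ _ _ _ _ nu mphi f).
- by apply: eq_measure_integral => A mA _; exact/esym/has_lawE.
- exact: measurable_int fi.
- exact: integrable_law.
Qed.

Lemma integrable_law_inv (f : m.-tuple R -> \bar R) :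
  measurable_fun setT f -> nu.-integrable setT (f \o phi) ->
  (prodm F_).-integrable setT f.
Proof.
move=> mf /integrableP[_ fi]; apply/integrableP; split => //.
rewrite (@ge0_integral_law (abse \o f))//.
  exact: measurableT_comp.
by move=> x; exact: abse_ge0.
Qed.

Lemma ae_law (Q : m.-tuple R -> Prop) :
  {ae prodm F_, forall x, Q x} -> {ae nu, forall w, Q (phi w)}.
Proof.
move=> [N [mN N0 QN]]; exists (phi @^-1` N); split.
- by rewrite -[X in measurable X]setTI; exact: (proj1 phiF).
- by rewrite has_lawE.
- by move=> w /= nQ; exact: QN.
Qed.

(** A null set of X need not be the preimage of a set of tuples. Measurability of Q makes the
    exceptional set itself a preimage whose mass the law computes. *)
Lemma ae_law_inv (Q : set (m.-tuple R)) : measurable Q ->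
  {ae nu, forall w, Q (phi w)} -> {ae prodm F_, forall x, Q x}.
Proof.
move=> mQ /negligibleP H; apply/negligibleP; first exact: measurableC.
transitivity (nu (phi @^-1` (~` Q))); first exact/esym/has_lawE/measurableC.
apply: H; rewrite (_ : ~` _ = [set: X] `&` phi @^-1` (~` Q)); last by rewrite setTI.
by apply: (proj1 phiF) => //; exact: measurableC.
Qed.

End change_of_variables.

Lemma has_law_cons (R : realType) m (F_ : 'I_m.+1 -> cdfType R) :
  has_law F_ [the probability _ _ of
     (ls (F_ ord0) \x prodm (fun i => F_ (lift ord0 i)))%E] (@tcons R m).
Proof. by split => //; exact: measurable_tcons. Qed.

(** * Iterated integrals as integrals against the product law *)

Section iterated_integrals.
Context (R : realType).
Local Open Scope ereal_scope.

(** For f of arbitrary sign and without integrability, Tonelli applies only to the positive and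
    negative parts of the integrand, and the integral is by definition their difference. The
    parameter space X absorbs one more coordinate at each induction step. *)
Lemma measurable_iter_int m (F_ : 'I_m -> cdfType R) (D : 'I_m -> set R) d
    (X : measurableType d) (f : X * m.-tuple R -> \bar R) :
  (forall i, measurable (D i)) -> measurable_fun setT f ->
  measurable_fun setT (fun x => iter_int F_ D (fun y => f (x, y))).
Proof.
elim: m F_ D d X f => [|m IH] F_ D d X f mD mf /=.
  by apply: measurableT_comp => //; exact: pair2_measurable.
pose g (xt : X * measurableTypeR R) :=
  iter_int (fun i => F_ (lift ord0 i)) (fun i => D (lift ord0 i))
    (fun y => f (xt.1, tcons (xt.2, y))).
have mg : measurable_fun setT g.
  pose f' (z : (X * measurableTypeR R) * m.-tuple R) := f (z.1.1, tcons (z.1.2, z.2)).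
  apply: (IH _ _ _ _ f') => //.
  apply: (measurableT_comp mf); apply: measurable_fun_pair.
    by apply: measurableT_comp; exact: measurable_fst.
  apply: (measurableT_comp (@measurable_tcons R m)); apply: measurable_fun_pair.
    by apply: measurableT_comp; [exact: measurable_snd|exact: measurable_fst].
  exact: measurable_snd.
pose h (xt : X * measurableTypeR R) := (g \_ [set xt | D ord0 xt.2]) xt.
have mh : measurable_fun setT h.
  apply/(measurable_restrictT g).
    rewrite -[X in measurable X]setTI.
    exact: (@measurable_snd _ _ X (measurableTypeR R) measurableT _ (mD ord0)).
  exact: measurable_funTS.
have E x : \int[ls (F_ ord0)]_(t in D ord0) g (x, t) =
    \int[ls (F_ ord0)]_t h^\+ (x, t) - \int[ls (F_ ord0)]_t h^\- (x, t).
  rewrite integral_mkcond integralE.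
  have -> : (fun t => g (x, t)) \_ (D ord0) = h \o pair x.
    apply/funext => t; rewrite /h /= !patchE.
    by congr (if _ then _ else _); apply/idP/idP; rewrite !inE.
  by congr (_ - _); apply: eq_integral => t _; rewrite (funepos_comp, funeneg_comp).
rewrite (_ : (fun x => _) = fun x => \int[ls (F_ ord0)]_(t in D ord0) g (x, t))//.
under eq_fun do rewrite E.
apply: emeasurable_funB.
- exact: (measurable_fun_fubini_tonelli_F (m2 := ls (F_ ord0)) h^\+ (measurable_funepos mh)).
- exact: (measurable_fun_fubini_tonelli_F (m2 := ls (F_ ord0)) h^\- (measurable_funeneg mh)).
Qed.

Lemma patch_rect_tcons m (D : 'I_m.+1 -> set R) (f : m.+1.-tuple R -> \bar R) t y :
  (f \_ (rect D)) (tcons (t, y)) =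
  if t \in D ord0 then ((fun y => f (tcons (t, y))) \_ (rect (fun i => D (lift ord0 i)))) y
  else 0.
Proof.
have E : (tcons (t, y) \in rect D) =
    (t \in D ord0) && (y \in rect (fun i => D (lift ord0 i))).
  have := congr1 (fun A : set (measurableTypeR R * m.-tuple R) => A (t, y)) (tcons_rect D).
  move=> /= E; apply/idP/andP; first by rewrite inE => H; move: H; rewrite [rect D _]E !inE.
  by rewrite !inE => -[H1 H2]; rewrite /= [rect D _]E.
by rewrite !patchE E; case: (t \in _).
Qed.

Lemma ge0_iter_intE m (F_ : 'I_m -> cdfType R) (D : 'I_m -> set R)
    (f : m.-tuple R -> \bar R) :
  (forall i, measurable (D i)) -> measurable_fun setT f -> (forall x, 0 <= f x) ->
  iter_int F_ D f = \int[prodm F_]_(x in rect D) f x.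
Proof.
elim: m F_ D f => [|m IH] F_ D f mD mf f0 /=.
  rewrite integral_dirac ?diracE; last 2 first.
  - exact: measurable_rect.
  - exact: measurable_funTS.
  by rewrite mem_set ?mul1e// => -[].
rewrite integral_mkcond [RHS]integral_mkcond.
have mfD : measurable_fun setT (f \_ (rect D)).
  by apply/(measurable_restrictT f); [exact: measurable_rect|exact: measurable_funTS].
have fD0 x : 0 <= (f \_ (rect D)) x by exact: erestrict_ge0.
rewrite -/(prodm F_) (ge0_integral_law (has_law_cons F_) mfD fD0).
rewrite (fubini_tonelli1 (fun z => (f \_ (rect D)) (tcons z)))//; last first.
  by apply: (measurableT_comp mfD); exact: measurable_tcons.
apply: eq_integral => t _; rewrite patchE /fubini_F.
under [RHS]eq_integral do rewrite patch_rect_tcons.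
case: ifPn => _; last by rewrite integral0.
rewrite -integral_mkcond -(IH _ _ (fun y => f (tcons (t, y))))//.
apply: (measurableT_comp mf).
exact: (measurableT_comp (@measurable_tcons R m) (pair1_measurable t)).
Qed.

(** Only almost every section of an integrable function is integrable, so the induction hypothesis
    holds for almost every value t of the first coordinate. The outer integrands agree almost
    everywhere, and [measurable_iter_int] is what allows their integrals to be equated. *)
Lemma iter_intE m (F_ : 'I_m -> cdfType R) (D : 'I_m -> set R)
    (f : m.-tuple R -> \bar R) :
  (forall i, measurable (D i)) -> (prodm F_).-integrable setT f ->
  iter_int F_ D f = \int[prodm F_]_(x in rect D) f x.
Proof.
elim: m F_ D f => [|m IH] F_ D f mD fi /=.
  have mf := measurable_int _ fi.
  rewrite integral_dirac ?diracE; last 2 first.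
  - exact: measurable_rect.
  - exact: measurable_funTS.
  by rewrite mem_set ?mul1e// => -[].
have mf := measurable_int _ fi.
rewrite integral_mkcond [RHS]integral_mkcond.
have fDi : (prodm F_).-integrable setT (f \_ (rect D)).
  apply/(integrable_mkcond _ (measurable_rect mD)).
  by apply: integrableS fi => //; exact: measurable_rect.
rewrite -/(prodm F_) (integral_law (has_law_cons F_) fDi).
have fDi' := integrable_law (has_law_cons F_) fDi.
have fi' := integrable_law (has_law_cons F_) fi.
rewrite -(integral12_prod_meas1 fDi').
apply: ae_eq_integral => //.
- apply/(@measurable_restrictT _ _ (measurableTypeR R) _ _ _ (mD ord0)).
  apply: measurable_funTS.
  apply: (@measurable_iter_int m _ _ _ (measurableTypeR R) (f \o @tcons R m)) => //.
  exact: (measurableT_comp mf (@measurable_tcons R m)).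
- by have := measurable_fubini_F fDi'.
- have := ae_integrable1 fi'.
  apply: filterS => t ti _; rewrite patchE /fubini_F /=.
  under [RHS]eq_integral do rewrite patch_rect_tcons.
  case: ifPn => _; last by rewrite integral0.
  by rewrite -integral_mkcond -(IH _ _ (fun y => f (tcons (t, y)))).
Qed.

End iterated_integrals.

(** * Laws of coordinate maps *)

Definition cyl (R : realType) n (J : {set 'I_n}) (b : n.-tuple R) : set (n.-tuple R) :=
  [set x | forall i, i \in J -> tnth x i <= tnth b i].

Definition splice (R : realType) n (J : {set 'I_n}) (x z : n.-tuple R) : n.-tuple R :=
  [tuple if i \in J then tnth x i else tnth z i | i < n].

Lemma boxE (R : realType) n (b : n.-tuple R) : box b = [set x | forall i, tnth x i <= tnth b i].
Proof.
by apply/seteqP; split => x xb i; have := xb i; rewrite /= in_itv.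
Qed.

Section laws.
Context (R : realType) (n : nat) (F_ : 'I_n -> cdfType R).

Lemma cyl_rect (J : {set 'I_n}) (b : n.-tuple R) :
  cyl J b = rect (fun i => if i \in J then `]-oo, tnth b i]%classic else setT).
Proof.
apply/seteqP; split => x xb i.
  by case: ifPn => // iJ; rewrite /= in_itv/=; exact: xb.
by move=> iJ; have := xb i; rewrite iJ /= in_itv.
Qed.

Lemma measurable_cyl (J : {set 'I_n}) (b : n.-tuple R) : measurable (cyl J b).
Proof. by rewrite cyl_rect; apply: measurable_rect => i; case: ifP. Qed.

Lemma prodm_cyl J (b : n.-tuple R) :
  prodm F_ (cyl J b) = (\prod_(i in J) (F_ i (tnth b i))%:E)%E.
Proof.
rewrite cyl_rect prodm_rect; last by move=> i; case: ifP.
rewrite [RHS]big_mkcond; apply: eq_bigr => i _.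
case: ifP => _; first exact: ls_itvNy.
exact: probability_setT.
Qed.

Lemma prodm_box (b : n.-tuple R) :
  prodm F_ (box b) = (\prod_(i < n) (F_ i (tnth b i))%:E)%E.
Proof.
rewrite prodm_rect//; apply: eq_bigr => i _; exact: ls_itvNy.
Qed.

Lemma tnth_fill_enum_val (J : {set 'I_n}) (y : #|J|.-tuple R) t j :
  tnth (fill y t) (enum_val j) = tnth y j.
Proof.
rewrite tnth_mktuple (tnth_nth t); congr nth.
by rewrite (enum_val_nth (enum_val j)) index_uniq ?enum_uniq// -cardE.
Qed.

Lemma tnth_fill_out (J : {set 'I_n}) (y : #|J|.-tuple R) t i :
  i \notin J -> tnth (fill y t) i = t.
Proof.
move=> iJ; rewrite tnth_mktuple nth_default// size_tuple leqNgt cardE index_mem.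
by rewrite mem_enum.
Qed.

(** The value s is a mere filler, since only coordinates in J of [fill y s] are read. The right-hand
    side is the form of the argument of F in [cvg_box_function]. *)
Lemma fillE (J : {set 'I_n}) (y : #|J|.-tuple R) s t :
  fill y t = [tuple if i \in J then tnth (fill y s) i else t | i < n].
Proof.
apply: eq_from_tnth => i; rewrite [RHS]tnth_mktuple; case: ifPn => iJ.
  by rewrite -(enum_rankK_in iJ iJ) !tnth_fill_enum_val.
exact: tnth_fill_out.
Qed.

Lemma coords_box (J : {set 'I_n}) (y : #|J|.-tuple R) t :
  coords J @^-1` box y = cyl J (fill y t).
Proof.
rewrite boxE; apply/seteqP; split => x /=.
  move=> xy i iJ; have := xy (enum_rank_in iJ i).
  by rewrite tnth_mktuple -(tnth_fill_enum_val y t) enum_rankK_in.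
by move=> xy j; rewrite tnth_mktuple -(tnth_fill_enum_val y t); apply: xy; exact: enum_valP.
Qed.

Lemma measurable_coords (J : {set 'I_n}) : measurable_fun setT (@coords R n J).
Proof.
apply/measurable_fun_tnthP => j.
rewrite (_ : _ \o _ = @tnth n R ^~ (enum_val j)); first exact: measurable_tnth.
by apply/funext => x; rewrite /= tnth_mktuple.
Qed.

Lemma has_law_coords (J : {set 'I_n}) :
  has_law (subfamily F_ (A := J)) (prodm F_) (coords J).
Proof.
split; first exact: measurable_coords.
move=> y; rewrite (coords_box y 0) prodm_cyl big_enum_val.
rewrite prodm_rect//; apply: eq_bigr => j _.
by rewrite tnth_fill_enum_val; exact/esym/ls_itvNy.
Qed.

Lemma measurable_subst_coord (k : 'I_n) :
  measurable_fun setT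
    (fun xt : n.-tuple R * measurableTypeR R => subst_coord k xt.2 xt.1).
Proof.
apply/measurable_fun_tnthP => i.
rewrite (_ : _ \o _ = fun xt => if i == k then xt.2 else tnth xt.1 i); last first.
  by apply/funext => x; rewrite /= tnth_mktuple.
case: eqP => _; first exact: measurable_snd.
apply: (measurableT_comp (@measurable_tnth _ R n i)).
exact: measurable_fst.
Qed.

(** The preimage of a box is a cylinder in the coordinates other than k times a half-line for the
    fresh variable; the discarded k-th coordinate is unconstrained and contributes a factor 1.
    [has_law_splice] splits in the same way between J and its complement. *)
Lemma has_law_subst_coord (k : 'I_n) :
  has_law F_ [the probability _ _ of (prodm F_ \x ls (F_ k))%E]
    (fun xt : n.-tuple R * measurableTypeR R => subst_coord k xt.2 xt.1).
Proof.
split; first exact: measurable_subst_coord.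
move=> b; rewrite prodm_box.
rewrite (_ : _ @^-1` _ = cyl (~: [set k])%SET b `*` `]-oo, tnth b k]%classic); last first.
  rewrite boxE; apply/seteqP; split => -[x t] /=.
    move=> xb; split.
      by move=> i; rewrite !inE => /negPf ik; have := xb i; rewrite tnth_mktuple ik.
    by have := xb k; rewrite tnth_mktuple eqxx in_itv.
  move=> [xb tb] i; rewrite tnth_mktuple; case: eqP => [->|/eqP ik].
    by move: tb; rewrite in_itv.
  by apply: xb; rewrite !inE.
rewrite /= product_measure1E//; last exact: measurable_cyl.
rewrite (bigD1 k)//= muleC; congr (_ * _)%E; first exact: ls_itvNy.
etransitivity; first exact: prodm_cyl.
by apply: eq_bigl => i; rewrite !inE.
Qed.

Lemma measurable_splice (J : {set 'I_n}) :
  measurable_fun setT (fun xz : n.-tuple R * n.-tuple R => splice J xz.1 xz.2).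
Proof.
apply/measurable_fun_tnthP => i.
rewrite (_ : _ \o _ = fun xz : n.-tuple R * n.-tuple R =>
    if i \in J then tnth xz.1 i else tnth xz.2 i); last first.
  by apply/funext => x; rewrite /= tnth_mktuple.
case: (i \in J); apply: (measurableT_comp (@measurable_tnth _ R n i)).
  exact: measurable_fst.
exact: measurable_snd.
Qed.

Lemma has_law_splice (J : {set 'I_n}) :
  has_law F_ [the probability _ _ of (prodm F_ \x prodm F_)%E]
    (fun xz : n.-tuple R * n.-tuple R => splice J xz.1 xz.2).
Proof.
split; first exact: measurable_splice.
move=> b; rewrite prodm_box.
rewrite (_ : _ @^-1` _ = cyl J b `*` cyl (~: J)%SET b); last first.
  rewrite boxE; apply/seteqP; split => -[x z] /=.
    move=> xb; split=> i.
      by move=> iJ; have := xb i; rewrite tnth_mktuple iJ.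
    by rewrite !inE => /negPf iJ; have := xb i; rewrite tnth_mktuple iJ.
  move=> [xb zb] i; rewrite tnth_mktuple; case: ifPn => iJ; first exact: xb.
  by apply: zb; rewrite inE.
rewrite /= product_measure1E//; [|exact: measurable_cyl|exact: measurable_cyl].
rewrite (bigID (mem J))/=; congr (_ * _)%E; first exact: prodm_cyl.
etransitivity; first exact: prodm_cyl.
by apply: eq_bigl => i; rewrite !inE.
Qed.

(** Independence and the cdf's of the [xi k] enter the proof here and afterwards act only through
    this law. *)
Lemma has_law_rvec d (T : measurableType d) (P : probability T R)
    (xi : 'I_n -> {RV P >-> R}) :
  mutually_independent xi ->
  (forall (k : 'I_n) (x : R), cdf (xi k) x = (F_ k x)%:E) ->
  has_law F_ P (rvec xi).
Proof.
move=> indep hcdf; split.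
  apply/measurable_fun_tnthP => i.
  rewrite (_ : _ \o _ = xi i)//.
  by apply/funext => w; rewrite /= tnth_mktuple.
move=> b; rewrite prodm_box.
have := indep finset.setT (fun i => `]-oo, tnth b i]%classic) (fun i => measurable_itv _).
rewrite (_ : \bigcap_(_ in _) _ = rvec xi @^-1` box b); last first.
  apply/seteqP; split => w wb i; first by rewrite /= tnth_mktuple; apply: wb; rewrite /= inE.
  by move=> _; have := wb i; rewrite /= tnth_mktuple.
move=> ->; apply: eq_big => [i|i _]; first by rewrite inE.
exact: hcdf.
Qed.

End laws.

(** * Integrals over boxes determine the integrand *)

Section boxes_determine_integrals.
Context (R : realType) (n : nat) (mu : probability (n.-tuple R) R).
Variable h : n.-tuple R -> \bar R.
Hypothesis hi : mu.-integrable setT h.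

Let mh : measurable_fun setT h := measurable_int _ hi.

(** Dominated convergence with |h| as bound: at a fixed x the finitely many coordinates all lie
    below u k from some k on, so the truncated integrand is eventually stationary. *)
Lemma cvg_integral_box (J : {set 'I_n}) (b : n.-tuple R) (u : R^nat) :
  u k @[k --> \oo] --> +oo ->
  (\int[mu]_(x in box [tuple if i \in J then tnth b i else u k | i < n]) h x
     @[k --> \oo] --> \int[mu]_(x in cyl J b) h x)%E.
Proof.
move=> uoo.
pose B k := box [tuple if i \in J then tnth b i else u k | i < n].
have mB k : measurable (B k) by exact: measurable_box.
rewrite [X in _ --> X]integral_mkcond.
rewrite (_ : (fun k => _) = fun k => (\int[mu]_x (h \_ (B k)) x)%E); last first.
  by apply/funext => k; rewrite integral_mkcond.
have [] := @dominated_convergence _ _ R mu setT measurableT (fun k => h \_ (B k))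
  (h \_ (cyl J b)) (abse \o h).
- by move=> k; apply/(measurable_restrictT _ (mB k)); exact: measurable_funTS.
- by apply/(measurable_restrictT _ (measurable_cyl J b)); exact: measurable_funTS.
- apply: aeW => x _; apply: cvg_near_cst.
  have ux : \forall k \near \oo, forall i : 'I_n, tnth x i <= u k.
    by apply: filter_forall => i; move/cvgryPge : uoo; exact.
  near=> k; rewrite !patchE; congr (if _ then _ else _).
  apply/idP/idP; rewrite !inE /B boxE.
    by move=> xB i iJ; have := xB i; rewrite tnth_mktuple iJ.
  move=> xJ i; rewrite tnth_mktuple; case: ifPn => iJ; first exact: xJ.
  by move: i {iJ}; near: k.
- exact: integrable_abse.
- apply: aeW => x k _; rewrite patchE; case: (x \in _); first exact: lexx.
  by rewrite abse0; exact: abse_ge0.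
- by move=> _ _.
Unshelve. all: by end_near. Qed.

(** Turns the limits at infinity in [has_marginals] and [marginal_cdf] into integrals over
    cylinders. *)
Lemma cvg_box_function (F : n.-tuple R -> R) (J : {set 'I_n}) (b : n.-tuple R) :
  (forall x, (F x)%:E = \int[mu]_(y in box x) h y)%E ->
  F [tuple if i \in J then tnth b i else t | i < n] @[t --> +oo]
    --> fine (\int[mu]_(y in cyl J b) h y)%E.
Proof.
move=> FE; apply/cvg_pinftyP => u uoo.
rewrite (_ : (fun k => _) = fun k =>
  fine (\int[mu]_(x in box [tuple if i \in J then tnth b i else u k | i < n]) h x)%E).
  apply: fine_cvg; rewrite fineK; first exact: cvg_integral_box.
  apply: integrable_fin_num; first exact: measurable_cyl.
  exact: integrableS (measurable_cyl _ _) _ hi.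
by apply/funext => k; rewrite -FE.
Qed.

Hypothesis hbox : forall b, (\int[mu]_(x in box b) h x = 0)%E.

(** As h has no sign, the pi-lambda theorem replaces uniqueness of measures: the sets over which h
    integrates to 0 form a Dynkin system containing the boxes. *)
Lemma integral_box_eq0 A : measurable A -> (\int[mu]_(x in A) h x = 0)%E.
Proof.
move=> mA.
(* The whole space is the cylinder over the empty index set, hence a limit of boxes. *)
have hT : (\int[mu]_x h x = 0)%E.
  have := @cvg_integral_box finset.set0 [tuple 0 | i < n] _ (@cvgr_idn R).
  under eq_fun do rewrite hbox.
  move=> /(cvg_lim (@ereal_hausdorff R)); rewrite lim_cst// => ->.
  congr (integral mu _ h).
  by apply/seteqP; split => // x _ i; rewrite inE.
apply: (@dynkin_induction _ (n.-tuple R) (range (@box R n))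
  (fun A => \int[mu]_(x in A) h x = 0)%E).
- exact: measurable_tuple_box.
- by move=> _ _ [b _ <-] [c _ <-]; rewrite boxI; eexists.
- exact: hT.
- by move=> _ [b _ <-].
- move=> S mS S0.
  have : (\int[mu]_(x in S `|` ~` S) h x = 0)%E by rewrite setUv hT.
  rewrite integral_setU//; last 3 first.
  - exact: measurableC.
  - by rewrite setUv.
  - by apply/disj_setPS; rewrite setICr.
  by rewrite S0 add0e.
- move=> F mF tF F0; rewrite integral_bigcup//.
    by apply: eseries0 => k _ _; exact: F0.
  by apply: integrableS hi => //; exact: bigcup_measurable.
- by rewrite -measurable_tuple_box.
Qed.

Lemma ae_box_eq0 : {ae mu, forall x, h x = 0%E}.
Proof.
have : ae_eq mu setT h (cst 0%E).
  apply: integral_ae_eq => // E _ mE.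
  by rewrite integral_box_eq0// integral0.
by apply: filterS => x; exact.
Qed.

End boxes_determine_integrals.

(** * Moebius inversion *)

Section alternating_sums.
Context (R : realType) (I : finType).
Implicit Types (A B J : {set I}) (c w H : {set I} -> R).

Lemma signr_subset A J : J \subset A ->
  (-1) ^+ (#|A| - #|J|) = (-1) ^+ #|A| * (-1) ^+ #|J| :> R.
Proof.
by move=> JA; rewrite -signr_odd oddB ?subset_leq_card// signr_addb !signr_odd.
Qed.

(* Toggling k in J changes the sign of the term of index J. *)
Lemma alternating_sum_eq0 A (k : I) c : k \in A ->
  (forall J, c (k |: J) = c (J :\ k)) ->
  \sum_(J : {set I} | J \subset A) (-1) ^+ #|J| * c J = 0.
Proof.
move=> kA ck; rewrite (bigID (fun J : {set I} => k \in J))/=.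
rewrite (reindex_onto (fun J => k |: J) (fun J => J :\ k))/=; last first.
  by move=> J /andP[_ kJ]; rewrite finset.setD1K.
rewrite (eq_bigl (fun J : {set I} => (J \subset A) && (k \notin J))); last first.
  move=> J; rewrite finset.subUset finset.sub1set kA setU11 /= andbT.
  apply/andP/andP => -[JA].
    by move=> /eqP JE; split=> //; rewrite -JE finset.setD11.
  by move=> kJ; rewrite JA finset.setU1K.
rewrite -big_split/= big1// => J /andP[_ kJ].
rewrite ck cardsU1 kJ add1n exprS mulN1r mulNr.
have -> : J :\ k = J by apply/finset.setDidPl; rewrite disjoint_sym disjoints1.
by rewrite addNr.
Qed.

(** If B is not A, some k in A lies outside B. Toggling k does not affect whether J contains B, so
    with this condition as a 0/1 coefficient the previous cancellation applies. *)
Lemma alternating_sum_between A B : B \subset A ->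
  \sum_(J : {set I} | (J \subset A) && (B \subset J)) (-1) ^+ #|J| =
  (B == A)%:R * (-1) ^+ #|A| :> R.
Proof.
move=> BA; have [->|BnA] := eqVneq B A.
  rewrite mul1r (big_pred1 A)// => J.
  by rewrite [RHS]finset.eqEsubset.
have /properP[_ [k kA kB]] : B \proper A by rewrite finset.properEneq BnA BA.
rewrite mul0r big_mkcondr/= -[RHS](alternating_sum_eq0 kA (c := fun J => (B \subset J)%:R)).
  by apply: eq_bigr => J _; case: ifP; rewrite (mulr1, mulr0).
move=> J; congr (nat_of_bool _)%:R.
rewrite finset.subsetD1 kB andbT; apply/idP/idP => [/fintype.subsetP BJ|].
  apply/fintype.subsetP => i iB; have := BJ i iB; rewrite in_setU1.
  by move=> /orP[/eqP ik|//]; rewrite -ik iB in kB.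
by move=> /fintype.subset_trans; apply; exact: finset.subsetUr.
Qed.

(** After exchanging the sums, the inner sum over J between B and A vanishes unless B = A. This
    direction recovers the components from their partial sums (uniqueness); [moebius_sum] rebuilds
    the density from its components (existence). *)
Lemma moebius_inversion w A :
  \sum_(J : {set I} | J \subset A) (-1) ^+ (#|A| - #|J|) *
    (\sum_(B : {set I} | B \subset J) w B) = w A.
Proof.
under eq_bigr => J JA do rewrite signr_subset// mulr_sumr.
rewrite (exchange_big_dep (fun B : {set I} => B \subset A))/=; last first.
  by move=> J B JA /fintype.subset_trans; exact.
under eq_bigr => B BA do
  rewrite -mulr_suml -mulr_sumr alternating_sum_between// mulrCA -expr2 sqrr_sign mulr1.
rewrite (bigD1 A)//= eqxx mul1r big1 ?addr0// => B /andP[_ /negPf ->].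
by rewrite mul0r.
Qed.

Lemma moebius_sum H A :
  \sum_(B : {set I} | B \subset A)
    \sum_(J : {set I} | J \subset B) (-1) ^+ (#|B| - #|J|) * H J = H A.
Proof.
rewrite (exchange_big_dep (fun J : {set I} => J \subset A))/=; last first.
  by move=> B J BA /fintype.subset_trans; exact.
under eq_bigr => J JA.
  under eq_bigr => B /andP[_ JB] do rewrite signr_subset//.
  rewrite -mulr_suml -mulr_suml alternating_sum_between//.
over.
rewrite (bigD1 A)//= eqxx mul1r -expr2 sqrr_sign mul1r big1 ?addr0// => J /andP[_ /negPf ->].
by rewrite !mul0r.
Qed.

End alternating_sums.

Section double_sums.
Context (R : realType) (n : nat).

(** Removes the grouping by cardinality used in [U_sum] and [f_incl_excl]; the bound m guarantees
    that no set is lost. *)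
Lemma sum_card_ge2 (P : pred {set 'I_n}) (f : {set 'I_n} -> R) (m : nat) :
  (forall A, P A -> #|A| <= m)%N ->
  \sum_(2 <= c < m.+1) \sum_(A : {set 'I_n} | P A && (#|A| == c)) f A =
  \sum_(A : {set 'I_n} | P A && (2 <= #|A|)%N) f A.
Proof.
move=> Pm; rewrite (exchange_big_dep P)/=; last by move=> i A _ /andP[].
rewrite [RHS]big_mkcondr; apply: eq_bigr => A PA.
under eq_bigl => c do rewrite PA eq_sym /=.
by rewrite big_nat1_eq ltnS Pm// andbT.
Qed.

Lemma U_sumE (g : forall A : {set 'I_n}, #|A|.-tuple R -> R) x :
  U_sum g x = \sum_(A : {set 'I_n} | (2 <= #|A|)%N) g A (coords A x).
Proof.
rewrite -(@sum_card_ge2 xpredT _ n)// => A _.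
by rewrite (leq_trans (max_card _))// card_ord.
Qed.

Lemma f_incl_exclE (dens : forall J : {set 'I_n}, #|J|.-tuple R -> R) A x :
  f_incl_excl dens A x =
  \sum_(J : {set 'I_n} | (J \subset A) && (2 <= #|J|)%N)
    (-1) ^+ (#|A| - #|J|) * (dens J (coords J x) - 1).
Proof.
rewrite -(@sum_card_ge2 (fun J => J \subset A) _ #|A|); last first.
  by move=> J; exact: subset_leq_card.
by apply: eq_bigr => k _; rewrite mulr_sumr; apply: eq_bigr => J /andP[_ /eqP ->].
Qed.

End double_sums.

(** * Averaging over coordinates *)

Section integration_over_coordinates.
Context (R : realType) (n : nat) (F_ : 'I_n -> cdfType R).
Local Notation mu := (prodm F_).
Local Open Scope ereal_scope.

Lemma subst_coord_out (k : 'I_n) (t : R) x i :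
  i != k -> tnth (subst_coord k t x) i = tnth x i.
Proof. by move=> /negPf ik; rewrite tnth_mktuple ik. Qed.

Lemma measurable_partial_integral (k : 'I_n) (h : n.-tuple R -> \bar R) :
  mu.-integrable setT h ->
  measurable_fun setT (fun x => \int[ls (F_ k)]_t h (subst_coord k t x)).
Proof.
move=> hi; have := integrable_law (has_law_subst_coord F_ k) hi.
exact: measurable_fubini_F.
Qed.

(** Replacing coordinate k by a fresh variable changes neither the law nor membership in E. The
    indicator of E therefore leaves the integral over the fresh variable, and what remains inside is
    0 almost everywhere. *)
Lemma integral_degenerate (k : 'I_n) (h : n.-tuple R -> \bar R) (E : set (n.-tuple R)) :
  mu.-integrable setT h -> measurable E ->
  (forall x t, E (subst_coord k t x) <-> E x) ->
  {ae mu, forall x, \int[ls (F_ k)]_t h (subst_coord k t x) = 0} ->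
  \int[mu]_(x in E) h x = 0.
Proof.
move=> hi mE Ek h0.
have hEi : mu.-integrable setT (h \_ E).
  by apply/(integrable_mkcond _ mE); exact: integrableS hi.
rewrite integral_mkcond (integral_law (has_law_subst_coord F_ k) hEi).
have hEi' := integrable_law (has_law_subst_coord F_ k) hEi.
rewrite -(integral12_prod_meas1 hEi').
rewrite (ae_eq_integral (cst 0))//; first by rewrite integral0.
  by have := measurable_fubini_F hEi'.
apply: filterS h0 => x hx _ /=; rewrite /fubini_F/=.
have [xE|xE] := pselect (E x).
  rewrite -[RHS]hx; apply: eq_integral => t _; rewrite patchE mem_set//.
  exact/Ek.
rewrite -[RHS](integral0 (ls (F_ k)) setT); apply: eq_integral => t _.
by rewrite patchE memNset// => /Ek.
Qed.

(** The bound passes to the whole space by monotone convergence along the boxes with all bounds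
    equal to k. In the applications the box integrals are values of a cdf. *)
Lemma integrable_box_le1 (G : n.-tuple R -> R) :
  measurable_fun setT G -> (forall x, (0 <= G x)%R) ->
  (forall b, \int[mu]_(x in box b) (G x)%:E <= 1) ->
  mu.-integrable setT (EFin \o G).
Proof.
move=> mG G0 G1.
pose B (k : nat) : set (n.-tuple R) :=
  box [tuple if i \in finset.set0 then tnth [tuple 0%R | i < n] i else k%:R%R | i < n].
have mB k : measurable (B k) by exact: measurable_box.
have BT : \bigcup_k B k = setT.
  by rewrite bigcup_box_nat; apply/seteqP; split => // x _ i; rewrite inE.
apply/integrableP; split; first exact/measurable_EFinP.
rewrite (@le_lt_trans _ _ 1) ?ltry//.
under eq_integral do rewrite /= ger0_norm//.
have BG : \int[mu]_(x in B k) (G x)%:E @[k --> \oo] --> \int[mu]_x (G x)%:E.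
  rewrite -[in X in _ --> X]BT; apply: ge0_nondecreasing_set_cvg_integral => //.
  - move=> k l kl; apply/subsetPset; rewrite /B !boxE => x xB i.
    by have := xB i; rewrite !tnth_mktuple inE => /le_trans; apply; rewrite ler_nat.
  - by move=> k; apply/measurable_EFinP; exact: measurable_funTS.
  - by move=> k x _; rewrite lee_fin.
rewrite -(cvg_lim (@ereal_hausdorff R) BG).
apply: lime_le; first by apply/cvg_ex; eexists; exact: BG.
by apply: nearW => k; exact: G1.
Qed.

End integration_over_coordinates.

Lemma measurable_fill (R : realType) n (J : {set 'I_n}) (t : R) :
  measurable_fun setT (fun y : #|J|.-tuple R => fill y t).
Proof.
apply/measurable_fun_tnthP => i.
have [iJ|iJ] := boolP (i \in J).
  rewrite (_ : _ \o _ = @tnth _ R ^~ (enum_rank_in iJ i)); first exact: measurable_tnth.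
  by apply/funext => y /=; rewrite -(tnth_fill_enum_val y t) enum_rankK_in.
rewrite (_ : _ \o _ = cst t); first exact: measurable_cst.
by apply/funext => y /=; rewrite tnth_fill_out.
Qed.

Lemma splice_coords (R : realType) n (J : {set 'I_n}) (x y z : n.-tuple R) :
  (forall i, i \in J -> tnth x i = tnth y i) -> splice J x z = splice J y z.
Proof.
move=> xy; apply: eq_from_tnth => i; rewrite !tnth_mktuple.
by case: ifPn => // /xy.
Qed.

Section averaging.
Context (R : realType) (n : nat) (F_ : 'I_n -> cdfType R).
Variable G : n.-tuple R -> R.
Hypotheses (mG : measurable_fun setT G) (G0 : forall x, 0 <= G x).
Local Notation mu := (prodm F_).
Hypothesis Gi : mu.-integrable setT (EFin \o G).
Local Open Scope ereal_scope.

(* E(G(xi) | xi_j, j in J) at xi = x. *)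
Definition average (J : {set 'I_n}) (x : n.-tuple R) : \bar R :=
  \int[mu]_z (G (splice J x z))%:E.

Let mGE : measurable_fun setT (EFin \o G).
Proof. exact/measurable_EFinP. Qed.

Let mGJ (J : {set 'I_n}) : measurable_fun setT
  (fun xz : n.-tuple R * n.-tuple R => (G (splice J xz.1 xz.2))%:E).
Proof. exact: (measurableT_comp mGE (measurable_splice J)). Qed.

Lemma average_ge0 J x : 0 <= average J x.
Proof. by apply: integral_ge0 => z _; rewrite lee_fin. Qed.

Lemma measurable_average J : measurable_fun setT (average J).
Proof.
by apply: (measurable_fun_fubini_tonelli_F _ (mGJ J)) => x; rewrite lee_fin.
Qed.

Lemma average_coords (J : {set 'I_n}) x y :
  (forall i, i \in J -> tnth x i = tnth y i) -> average J x = average J y.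
Proof.
by move=> xy; apply: eq_integral => z _; rewrite (splice_coords _ xy).
Qed.

Lemma average_setT x : average finset.setT x = (G x)%:E.
Proof.
rewrite /average -[RHS]mule1 -(probability_setT mu) -integral_cst//.
apply: eq_integral => z _; congr (G _)%:E.
by apply: eq_from_tnth => i; rewrite tnth_mktuple inE.
Qed.

Lemma average_set0 x : average finset.set0 x = \int[mu]_z (G z)%:E.
Proof.
apply: eq_integral => z _; congr (G _)%:E.
by apply: eq_from_tnth => i; rewrite tnth_mktuple inE.
Qed.

Lemma average_subst_out (J : {set 'I_n}) k t x :
  k \notin J -> average J (subst_coord k t x) = average J x.
Proof.
move=> kJ; apply: average_coords => i iJ; rewrite subst_coord_out//.
by apply: contraNneq kJ => <-.
Qed.

(** In the average over the coordinates outside J \ k, resample the k-th coordinate of z and, by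
    Tonelli, integrate this fresh value outermost: it then plays the part of the k-th coordinate of
    x. The identity holds at every x, possibly with infinite values. *)
Lemma integral_average_subst (J : {set 'I_n}) k x : k \in J ->
  \int[ls (F_ k)]_t average J (subst_coord k t x) = average (J :\ k)%SET x.
Proof.
move=> kJ.
have mGx : measurable_fun setT (fun z => (G (splice (J :\ k)%SET x z))%:E).
  exact: (measurableT_comp (mGJ _) (pair1_measurable x)).
rewrite {2}/average (ge0_integral_law (has_law_subst_coord F_ k) mGx); last first.
  by move=> z; rewrite lee_fin.
rewrite (fubini_tonelli2 (fun zt : n.-tuple R * measurableTypeR R =>
  (G (splice (J :\ k)%SET x (subst_coord k zt.2 zt.1)))%:E))//; last 2 first.
- exact: (measurableT_comp mGx (measurable_subst_coord k)).
- by move=> z; rewrite lee_fin.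
apply: eq_integral => t _; apply: eq_integral => z _; congr (G _)%:E.
apply: eq_from_tnth => i; rewrite !tnth_mktuple !inE.
by case: eqP => [->|]; rewrite ?kJ.
Qed.

(** The defining property of the conditional expectation given the coordinates in J; the second
    hypothesis says that E is an event in these coordinates, so its indicator leaves the integral
    over z. *)
Lemma integral_average (J : {set 'I_n}) (E : set (n.-tuple R)) :
  measurable E -> (forall x z, E (splice J x z) <-> E x) ->
  \int[mu]_(x in E) average J x = \int[mu]_(x in E) (G x)%:E.
Proof.
move=> mE EJ.
have mGE' : measurable_fun setT ((EFin \o G) \_ E).
  by apply/(measurable_restrictT _ mE); exact: measurable_funTS.
have GE0 x : 0 <= ((EFin \o G) \_ E) x by apply: erestrict_ge0 => y _; rewrite lee_fin.
rewrite integral_mkcond [RHS]integral_mkcond.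
rewrite (ge0_integral_law (has_law_splice F_ J) mGE' GE0).
rewrite (fubini_tonelli1 (fun xz => ((EFin \o G) \_ E) (splice J xz.1 xz.2)))//; last first.
  exact: (measurableT_comp mGE' (measurable_splice J)).
apply: eq_integral => x _; rewrite patchE /fubini_F /=; case: ifPn => xE.
  apply: eq_integral => z _; rewrite patchE mem_set//.
  by apply/EJ; move: xE; rewrite inE.
rewrite -[LHS](integral0 mu setT); apply: eq_integral => z _.
by rewrite patchE memNset// => /EJ; move: xE; rewrite notin_setE.
Qed.

Lemma integrable_average J : mu.-integrable setT (average J).
Proof.
apply/integrableP; split; first exact: measurable_average.
under eq_integral do rewrite gee0_abs ?average_ge0//.
rewrite integral_average//.
have /integrableP[_] := Gi.
by under eq_integral do rewrite gee0_abs ?lee_fin//.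
Qed.

Lemma ae_average_fin_num : {ae mu, forall x, forall J, average J x \is a fin_num}.
Proof.
apply: filter_forall => J.
by have := integrable_ae measurableT (integrable_average J); apply: filterS => x; exact.
Qed.

Section marginal.
Variable J : {set 'I_n}.
Local Notation muJ := (prodm (subfamily F_ (A := J))).

(** The filler 0 is never seen, because [average J] ignores the coordinates outside J. *)
Definition margin (y : #|J|.-tuple R) : \bar R := average J (fill y 0).

Lemma margin_coords x : margin (coords J x) = average J x.
Proof.
apply: average_coords => i iJ.
by rewrite -(enum_rankK_in iJ iJ) tnth_fill_enum_val tnth_mktuple.
Qed.

Lemma measurable_margin : measurable_fun setT margin.
Proof. exact: (measurableT_comp (measurable_average J) (@measurable_fill R n J 0%R)). Qed.

Lemma margin_ge0 y : 0 <= margin y.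
Proof. exact: average_ge0. Qed.

Lemma integrable_margin : muJ.-integrable setT margin.
Proof.
apply: (integrable_law_inv (has_law_coords F_ J)); first exact: measurable_margin.
rewrite (_ : _ \o _ = average J); first exact: integrable_average.
by apply/funext => x; exact: margin_coords.
Qed.

Lemma integral_margin E : measurable E ->
  \int[muJ]_(y in E) margin y = \int[mu]_(x in coords J @^-1` E) (G x)%:E.
Proof.
move=> mE; rewrite -(@integral_average J); last 2 first.
- by rewrite -[X in measurable X]setTI; exact: measurable_coords.
- move=> x z /=; rewrite (_ : coords J (splice J x z) = coords J x)//.
  by apply: eq_from_tnth => j; rewrite !tnth_mktuple enum_valP.
rewrite integral_mkcond [RHS]integral_mkcond.
rewrite (ge0_integral_law (has_law_coords F_ J)).
- apply: eq_integral => x _; rewrite !patchE margin_coords.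
  by congr (if _ then _ else _); apply/idP/idP; rewrite !inE.
- by apply/(measurable_restrictT _ mE); apply: measurable_funTS; exact: measurable_margin.
- by apply: erestrict_ge0 => y _; exact: margin_ge0.
Qed.

End marginal.
End averaging.

(** * Marginal densities *)

Section support.
Context (R : realType).
Local Open Scope ereal_scope.

(** The complement of the support of df. *)
Definition null_points (f : cdfType R) : set R :=
  [set r | exists2 e : R, (0 < e)%R & ls f `](r - e)%R, (r + e)%R[%classic = 0].

(** An enumeration of the null intervals with rational endpoints, through codes of pairs of
    rationals. It exhibits the complement of the support as a countable union of null sets. *)
Definition null_cell (f : cdfType R) (k : nat) : set R :=
  if unpickle k is Some pq then
    let I := `](ratr (pq : rat * rat).1), (ratr pq.2)[%classic in
    if ls f I == 0 then I else set0
  else set0.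

Lemma null_pointsE (f : cdfType R) : null_points f = \bigcup_k null_cell f k.
Proof.
apply/seteqP; split => r.
  move=> [e e0 re0].
  have /rat_in_itvoo[p pr] : (r - e < r)%R by rewrite ltrBlDr ltrDl.
  have /rat_in_itvoo[q qr] : (r < r + e)%R by rewrite ltrDl.
  exists (pickle (p, q)); [exact: Logic.I|rewrite /null_cell pickleK].
  move: pr qr; rewrite !in_itv/= => /andP[p1 p2] /andP[q1 q2].
  rewrite ifT; first by rewrite /= in_itv/= p2.
  apply/eqP; apply: (subset_measure0 _ _ _ re0) => //.
  by move=> s /=; rewrite !in_itv/= => /andP[/(lt_trans p1) -> /lt_trans ->].
move=> [k _]; rewrite /null_cell; case: unpickle => [[p q]/=|//].
case: ifPn => // /eqP I0; rewrite /= in_itv/= => /andP[pr rq].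
exists (Num.min (r - ratr p) (ratr q - r))%R; first by rewrite lt_min !subr_gt0 pr.
apply: (subset_measure0 _ _ _ I0) => //.
move=> s; rewrite /= !in_itv/= => /andP[s1 s2]; apply/andP; split.
  by apply: le_lt_trans s1; rewrite lerBrDr -lerBrDl ge_min lexx.
by apply: lt_le_trans s2 _; rewrite -lerBrDl ge_min lexx orbT.
Qed.

Let measurable_null_cell f k : measurable (null_cell f k).
Proof. by rewrite /null_cell; case: unpickle => // pq; case: ifP. Qed.

Lemma measurable_null_points (f : cdfType R) : measurable (null_points f).
Proof. by rewrite null_pointsE; exact: bigcup_measurable. Qed.

Lemma ls_null_points (f : cdfType R) : ls f (null_points f) = 0.
Proof.
apply/negligibleP; first exact: measurable_null_points.
rewrite null_pointsE; apply: negligible_bigcup => k.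
apply/negligibleP; first exact: measurable_null_cell.
rewrite /null_cell; case: unpickle => [pq|]; last exact: measure0.
by case: ifPn => [/eqP //|_]; exact: measure0.
Qed.

(** The mass of a cube is the product of the masses of its sides, hence positive exactly when every
    side has positive mass. *)
Lemma prod_supportE m (F_ : 'I_m -> cdfType R) :
  prod_support F_ = rect (fun i => ~` null_points (F_ i)).
Proof.
have E (x : m.-tuple R) e : iter_int F_
    (fun i => `](tnth x i - e)%R, (tnth x i + e)%R[%classic) (cst 1) =
    \prod_(i < m) ls (F_ i) `](tnth x i - e)%R, (tnth x i + e)%R[%classic.
  rewrite ge0_iter_intE//.
  rewrite integral_cst ?mul1e; [exact: prodm_rect|exact: measurable_rect].
apply/seteqP; split => x.
  move=> xS i [e e0 xi0]; have := xS e e0; rewrite E (bigD1 i)//= xi0 mul0e.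
  by rewrite ltxx.
move=> xN e e0; rewrite E; elim/big_ind: _ => //.
  by move=> a b; exact: mule_gt0.
move=> i _; rewrite lt0e measure_ge0 andbT; apply/eqP => xi0.
by apply: (xN i); exists e.
Qed.

Lemma measurable_prod_support m (F_ : 'I_m -> cdfType R) :
  measurable (prod_support F_).
Proof.
rewrite prod_supportE; apply: measurable_rect => i.
apply: measurableC; exact: measurable_null_points.
Qed.

(** One null condition per coordinate is excluded. The convention that a marginal density is 1 off
    the support thus alters it on a null set only. *)
Lemma ae_prod_support m (F_ : 'I_m -> cdfType R) :
  {ae prodm F_, forall x, prod_support F_ x}.
Proof.
rewrite prod_supportE; apply: filter_forall => i.
exists (rect (fun j => if j == i then null_points (F_ i) else setT)); split.
- by apply: measurable_rect => j; case: ifP => // _; exact: measurable_null_points.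
- rewrite prodm_rect; last by move=> j; case: ifP => // _; exact: measurable_null_points.
  rewrite (bigD1 i)//= eqxx ls_null_points mul0e//.
- move=> x /= /contrapT xi j; case: eqP => // ->; exact: xi.
Qed.

End support.

Section marginal_density.
Context (R : realType) (n : nat) (F_ : 'I_n -> cdfType R).
Local Notation mu := (prodm F_).
Variable F : n.-tuple R -> R.

Lemma marginal_cdfE (h : n.-tuple R -> R) (J : {set 'I_n}) (y : #|J|.-tuple R) :
  mu.-integrable setT (EFin \o h) ->
  (forall x, (F x)%:E = \int[mu]_(z in box x) (h z)%:E)%E ->
  (marginal_cdf F y)%:E = (\int[mu]_(z in coords J @^-1` box y) (h z)%:E)%E.
Proof.
move=> hi FE; rewrite (coords_box y 0) /marginal_cdf.
have := cvg_box_function hi (J := J) (b := fill y 0) FE.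
rewrite (_ : (fun t : R => F _) = fun t => F (fill y t)); last first.
  by apply/funext => t; rewrite [in RHS](fillE y 0).
move=> /(cvg_lim (@Rhausdorff R)) ->; rewrite fineK//.
apply: integrable_fin_num; first exact: measurable_cyl.
exact: integrableS (measurable_cyl _ _) _ hi.
Qed.

Lemma marginal_cdf_le1 (h : n.-tuple R -> R) (J : {set 'I_n}) (y : #|J|.-tuple R) :
  mu.-integrable setT (EFin \o h) ->
  (forall x, (F x)%:E = \int[mu]_(z in box x) (h z)%:E)%E ->
  (forall x, F x <= 1) -> marginal_cdf F y <= 1.
Proof.
move=> hi FE F1; rewrite /marginal_cdf; apply: limr_le; last exact: nearW.
have := cvg_box_function hi (J := J) (b := fill y 0) FE.
rewrite (_ : (fun t : R => F _) = fun t => F (fill y t)); last first.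
  by apply/funext => t; rewrite [in RHS](fillE y 0).
by move=> Fl; apply/cvg_ex; eexists; exact: Fl.
Qed.

Lemma marginal_density_exists (V : n.-tuple R -> R) (J : {set 'I_n}) :
  measurable_fun setT V -> (forall x, 0 <= V x) -> mu.-integrable setT (EFin \o V) ->
  (forall x, (F x)%:E = \int[mu]_(z in box x) (V z)%:E)%E ->
  exists G : #|J|.-tuple R -> R, is_marginal_density F_ F G.
Proof.
move=> mV V0 Vi FE.
set FJ := subfamily F_ (A := J).
(* The value 1 is the convention off the support; [fine] replaces the infinite values that the
   margin may take on a null set. *)
pose G y := if y \in prod_support FJ then fine (margin F_ V (J := J) y) else 1.
have mG : measurable_fun setT G.
  apply: measurable_fun_ifT => //.
  - apply: (measurable_fun_bool true); rewrite setTI.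
    rewrite (_ : _ @^-1` _ = prod_support FJ); first exact: measurable_prod_support.
    by apply/seteqP; split => y /= => [/set_mem|/mem_set].
  - by apply: measurableT_comp => //; exact: measurable_margin.
have G0 y : 0 <= G y.
  by rewrite /G; case: ifP => // _; rewrite fine_ge0// margin_ge0.
exists G; split; last by move=> y yS; rewrite /G memNset.
split => // y; rewrite (marginal_cdfE y Vi FE) /cdf_int ge0_iter_intE//;
  last exact/measurable_EFinP.
rewrite -/(box y) -integral_margin//; last exact: measurable_box.
apply: ge0_ae_eq_integral.
- exact: measurable_box.
- by apply: measurable_funTS; exact: measurable_margin.
- by apply: measurable_funTS; exact/measurable_EFinP.
- by move=> x _; exact: margin_ge0.
- by move=> x _; rewrite lee_fin.
have := integrable_ae measurableT (integrable_margin mV V0 Vi J).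
apply: filterS2 (ae_prod_support FJ) => z zS /(_ I) zfin _.
by rewrite /= /G mem_set// fineK.
Qed.

End marginal_density.

(** * Degenerate families *)

Section degenerate_families.
Context (R : realType) (n : nat) (F_ : 'I_n -> cdfType R).
Local Notation mu := (prodm F_).
Variable g : forall A : {set 'I_n}, #|A|.-tuple R -> R.

(* The constant 1 as the component of index set0, so that 1 + U_n becomes the
   sum of all components. *)
Definition component (A : {set 'I_n}) (x : n.-tuple R) : R :=
  if (2 <= #|A|)%N then g (coords A x) else (A == finset.set0)%:R.

Definition partial_sum (J : {set 'I_n}) (x : n.-tuple R) : R :=
  \sum_(A : {set 'I_n} | A \subset J) component A x.

Lemma partial_sum_ge2 J x :
  partial_sum J x =
  1 + \sum_(A : {set 'I_n} | (A \subset J) && (2 <= #|A|)%N) g (coords A x).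
Proof.
rewrite /partial_sum (bigD1 finset.set0)/= ?finset.sub0set//.
rewrite {1}/component cards0 eqxx; congr (_ + _).
rewrite big_mkcondr [RHS]big_mkcondr; apply: eq_bigr => A _.
by rewrite /component; have [->|A0] := eqVneq A finset.set0; [rewrite cards0|case: ifP].
Qed.

Lemma partial_sumT x : partial_sum finset.setT x = 1 + U_sum g x.
Proof.
rewrite partial_sum_ge2 U_sumE; congr (_ + _); apply: eq_bigl => A.
by rewrite finset.subsetT.
Qed.

Lemma partial_sum_small (J : {set 'I_n}) x : (#|J| < 2)%N -> partial_sum J x = 1.
Proof.
move=> J2; rewrite partial_sum_ge2 big1 ?addr0// => A /andP[/subset_leq_card AJ].
by rewrite leqNgt (leq_ltn_trans AJ).
Qed.

Lemma partial_sum_coords (J : {set 'I_n}) x y :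
  (forall i, i \in J -> tnth x i = tnth y i) -> partial_sum J x = partial_sum J y.
Proof.
move=> xy; apply: eq_bigr => A AJ; rewrite /component; case: ifP => // _.
congr (g _); apply: eq_from_tnth => j; rewrite !tnth_mktuple; apply: xy.
exact: (fintype.subsetP AJ _ (enum_valP j)).
Qed.

Hypotheses (gi : forall A : {set 'I_n}, (2 <= #|A|)%N ->
     mu.-integrable setT (fun x => (g (coords A x))%:E))
  (g0 : forall (A : {set 'I_n}) (k : 'I_n), (2 <= #|A|)%N -> k \in A ->
     {ae mu, forall x, partial_int F_ g A k x = 0%E}).

Lemma integrable_component A : mu.-integrable setT (fun x => (component A x)%:E).
Proof.
rewrite /component; case: (leqP 2 #|A|) => A2; first exact: gi.
exact: finite_measure_integrable_cst.
Qed.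

Lemma integral_partial_sum J E : measurable E ->
  (\int[mu]_(x in E) (partial_sum J x)%:E =
   \sum_(A : {set 'I_n} | A \subset J) \int[mu]_(x in E) (component A x)%:E)%E.
Proof.
move=> mE; rewrite -integral_sum//.
  by apply: eq_integral => x _; rewrite sumEFin.
by move=> A; apply: integrableS (integrable_component A).
Qed.

Lemma integrable_partial_sum J : mu.-integrable setT (fun x => (partial_sum J x)%:E).
Proof.
rewrite (_ : (fun x => _) = fun x =>
    (\sum_(A : {set 'I_n} | A \subset J) (component A x)%:E)%E).
  by apply: integrable_sum => // A _; exact: integrable_component.
by apply/funext => x; rewrite sumEFin.
Qed.

(** A set A not contained in J has an index k outside J, and E is blind to coordinate k; so the
    component of A integrates to 0 over E. For a singleton A the component is 0 already. *)
Lemma integral_partial_sumT (J : {set 'I_n}) (E : set (n.-tuple R)) : measurable E ->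
  (forall k x t, k \notin J -> E (subst_coord k t x) <-> E x) ->
  (\int[mu]_(x in E) (1 + U_sum g x)%:E = \int[mu]_(x in E) (partial_sum J x)%:E)%E.
Proof.
move=> mE Ek; under eq_integral do rewrite -partial_sumT.
rewrite !integral_partial_sum// [RHS]big_mkcond [LHS]big_mkcond/=.
apply: eq_bigr => A _; rewrite finset.subsetT; case: ifPn => // /subsetPn[k kA kJ].
have [A2|A2] := leqP 2 #|A|.
  apply: (@integral_degenerate _ _ _ k) => //; first exact: integrable_component.
    by move=> x t; exact: Ek.
  apply: filterS (g0 A2 kA) => x.
  by rewrite /partial_int /component A2.
rewrite /component leqNgt A2/=; case: eqP => [A0|_]; first by rewrite A0 inE in kA.
by rewrite integral0.
Qed.

Lemma integral_partial_sum_coords (J : {set 'I_n}) (E : set (#|J|.-tuple R)) : measurable E ->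
  (\int[mu]_(x in coords J @^-1` E) (1 + U_sum g x)%:E =
   \int[mu]_(x in coords J @^-1` E) (partial_sum J x)%:E)%E.
Proof.
move=> mE; apply: integral_partial_sumT.
  by rewrite -[X in measurable X]setTI; exact: measurable_coords.
move=> k x t kJ /=; rewrite (_ : coords J (subst_coord k t x) = coords J x)//.
apply: eq_from_tnth => j; rewrite !tnth_mktuple.
case: eqP => // jk; have := enum_valP j.
by rewrite jk (negPf kJ).
Qed.

Variable F : n.-tuple R -> R.
Hypotheses (F1 : forall x, F x <= 1)
  (FE : forall x, (F x)%:E = (\int[mu]_(z in box x) (1 + U_sum g z)%:E)%E).

Lemma marginal_density_unique (J : {set 'I_n}) (dens : #|J|.-tuple R -> R) :
  is_density (subfamily F_ (A := J)) (marginal_cdf F (J := J)) dens ->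
  {ae mu, forall x, dens (coords J x) = partial_sum J x}.
Proof.
move=> [mdens dens0 densE].
have Ui : mu.-integrable setT (EFin \o (fun x => 1 + U_sum g x)).
  apply: eq_integrable (integrable_partial_sum finset.setT) => // x _ /=.
  by rewrite partial_sumT.
have mdE : measurable_fun setT (EFin \o dens) by exact/measurable_EFinP.
have densE' y : (\int[prodm (subfamily F_ (A := J))]_(z in box y) (dens z)%:E =
    (marginal_cdf F y)%:E)%E.
  by rewrite densE /cdf_int ge0_iter_intE// => z; rewrite lee_fin.
(* A marginal cdf is a limit of values of F, so it inherits the bound 1, and [dens] is
   integrable. *)
have di : (prodm (subfamily F_ (A := J))).-integrable setT (EFin \o dens).
  apply: integrable_box_le1 => // y.
  by rewrite densE' lee_fin; exact: (marginal_cdf_le1 y Ui FE F1).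
pose p (y : #|J|.-tuple R) := (partial_sum J (fill y 0))%:E.
have pE x : p (coords J x) = (partial_sum J x)%:E.
  congr EFin; apply: partial_sum_coords => i iJ.
  by rewrite -(enum_rankK_in iJ iJ) tnth_fill_enum_val tnth_mktuple.
have pi : (prodm (subfamily F_ (A := J))).-integrable setT p.
  apply: (integrable_law_inv (has_law_coords F_ J)).
    have := measurable_int _ (integrable_partial_sum J) => mp.
    exact: (measurableT_comp mp (@measurable_fill R n J 0)).
  by apply: eq_integrable (integrable_partial_sum J) => // x _; rewrite /= pE.
have dpi := integrableB measurableT di pi.
have dp0 : forall y, (\int[prodm (subfamily F_ (A := J))]_(z in box y)
    ((EFin \o dens) \- p) z = 0)%E.
  move=> y; have my := measurable_box y.
  rewrite integralB//; [|exact: integrableS di|exact: integrableS pi].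
  rewrite densE' (marginal_cdfE y Ui FE) integral_partial_sum_coords//.
  rewrite [X in (_ - X)%E](_ : _ =
      \int[mu]_(x in coords J @^-1` box y) (partial_sum J x)%:E)%E.
    rewrite subee// integrable_fin_num//.
      by rewrite -[X in measurable X]setTI; exact: measurable_coords.
    apply: integrableS (integrable_partial_sum J) => //.
    by rewrite -[X in measurable X]setTI; exact: measurable_coords.
  have pyi : (prodm (subfamily F_ (A := J))).-integrable setT (p \_ (box y)).
    by apply/(integrable_mkcond _ my); exact: integrableS pi.
  rewrite integral_mkcond [RHS]integral_mkcond (integral_law (has_law_coords F_ J) pyi).
  apply: eq_integral => x _; rewrite !patchE pE.
  by congr (if _ then _ else _); apply/idP/idP; rewrite !inE.
have := ae_law (has_law_coords F_ J) (ae_box_eq0 dpi dp0).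
apply: filterS => x dx.
have : ((dens (coords J x))%:E - p (coords J x) = 0)%E by exact: dx.
rewrite pE -EFinB => -[] /eqP.
by rewrite subr_eq0 => /eqP.
Qed.

End degenerate_families.

(** * The components of a given density *)

Section family_of_density.
Context (R : realType) (n : nat) (F_ : 'I_n -> cdfType R).
Local Notation mu := (prodm F_).
Variables (F G : n.-tuple R -> R).
Hypotheses (F1 : forall x, F x <= 1) (mG : measurable_fun setT G) (G0 : forall x, 0 <= G x)
  (FG : forall x, (F x)%:E = (\int[mu]_(z in box x) (G z)%:E)%E).

Lemma integrable_density : mu.-integrable setT (EFin \o G).
Proof. by apply: integrable_box_le1 => // b; rewrite -FG lee_fin. Qed.

Let Gi := integrable_density.

(* The terms with |J| <= 1, absent from f_A, cancel each other a.e. because then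
   the average is 1. *)
Definition density_component (A : {set 'I_n}) (y : #|A|.-tuple R) : R :=
  \sum_(J : {set 'I_n} | J \subset A)
    (-1) ^+ (#|A| - #|J|) * fine (average F_ G J (fill y 0)).

Lemma density_component_coords A x :
  density_component (coords A x) =
  \sum_(J : {set 'I_n} | J \subset A)
    (-1) ^+ (#|A| - #|J|) * fine (average F_ G J x).
Proof.
apply: eq_bigr => J JA; congr (_ * fine _); apply: average_coords => i iJ.
have iA := fintype.subsetP JA _ iJ.
by rewrite -(enum_rankK_in iA iA) tnth_fill_enum_val tnth_mktuple.
Qed.

Lemma measurable_density_component A : measurable_fun setT (@density_component A).
Proof.
rewrite /density_component; under eq_fun do rewrite big_mkcond/=.
apply: measurable_sum => J; case: (J \subset A) => //.
apply: measurable_funM => //.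
apply: measurableT_comp => //.
exact: (measurableT_comp (measurable_average F_ mG G0 J) (@measurable_fill R n A 0)).
Qed.

Lemma integrable_fine_average J :
  mu.-integrable setT (fun x => (fine (average F_ G J x))%:E).
Proof.
apply: le_integrable (integrable_average mG G0 Gi J) => //.
  apply/measurable_EFinP; apply: measurableT_comp => //.
  exact: measurable_average.
move=> x _; rewrite /= gee0_abs ?average_ge0// ger0_norm ?fine_ge0 ?average_ge0//.
have := average_ge0 F_ G0 J x.
by case: (average F_ G J x) => [r| |]//= _; exact: leey.
Qed.

Lemma integrable_density_component A :
  mu.-integrable setT (fun x => (density_component (coords A x))%:E).
Proof.
rewrite (_ : (fun x => _) = fun x => (\sum_(J : {set 'I_n} | J \subset A)
    ((-1) ^+ (#|A| - #|J|))%:E * (fine (average F_ G J x))%:E)%E).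
  by apply: integrable_sum => // J _; apply: integrableZl => //; exact: integrable_fine_average.
apply/funext => x; rewrite density_component_coords -sumEFin.
by apply: eq_bigr => J _; rewrite EFinM.
Qed.

(** For k in J, finiteness of the average over J \ k says that the section in t is integrable, hence
    finite for almost every t, so [fine] does not change its integral. For k outside J the section
    is constant and J \ k = J. *)
Lemma integral_fine_average_subst (J : {set 'I_n}) k x :
  average F_ G J x \is a fin_num -> average F_ G (J :\ k)%SET x \is a fin_num ->
  (ls (F_ k)).-integrable setT (fun t => (fine (average F_ G J (subst_coord k t x)))%:E) /\
  (\int[ls (F_ k)]_t (fine (average F_ G J (subst_coord k t x)))%:E =
    (fine (average F_ G (J :\ k)%SET x))%:E)%E.
Proof.
move=> Jx Jkx; have [kJ|kJ] := boolP (k \in J); last first.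
  have -> : (J :\ k)%SET = J by apply/finset.setDidPl; rewrite disjoint_sym disjoints1.
  have -> : (fun t => (fine (average F_ G J (subst_coord k t x)))%:E) =
      cst (fine (average F_ G J x))%:E.
    by apply/funext => t; rewrite average_subst_out.
  split; first exact: finite_measure_integrable_cst.
  rewrite integral_cst//; rewrite -[RHS]mule1; congr (_ * _)%E.
  exact: probability_setT.
have ma : measurable_fun setT (fun t : measurableTypeR R => average F_ G J (subst_coord k t x)).
  apply: (measurableT_comp (measurable_average F_ mG G0 J)).
  exact: (measurableT_comp (measurable_subst_coord k) (pair1_measurable x)).
have ia : (ls (F_ k)).-integrable setT (fun t => average F_ G J (subst_coord k t x)).
  apply/integrableP; split => //.
  under eq_integral do rewrite gee0_abs ?average_ge0//.
  by rewrite integral_average_subst// ltey_eq Jkx.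
have ae_fin : ae_eq (ls (F_ k)) setT
    (fun t => (fine (average F_ G J (subst_coord k t x)))%:E)
    (fun t => average F_ G J (subst_coord k t x)).
  have := integrable_ae measurableT ia; apply: filterS => t /(_ I) ft _.
  by rewrite fineK.
have mfa : measurable_fun setT (fun t : measurableTypeR R =>
    (fine (average F_ G J (subst_coord k t x)))%:E).
  by apply/measurable_EFinP; apply: measurableT_comp ma.
have E : (\int[ls (F_ k)]_t (fine (average F_ G J (subst_coord k t x)))%:E =
    (fine (average F_ G (J :\ k)%SET x))%:E)%E.
  rewrite fineK// -(integral_average_subst F_ mG G0)//.
  exact: ae_eq_integral.
split=> //; apply/integrableP; split => //.
under eq_integral do rewrite gee0_abs ?lee_fin ?fine_ge0 ?average_ge0//.
by rewrite E ltry.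
Qed.

Lemma degenerate_density_component (A : {set 'I_n}) k : k \in A ->
  {ae mu, forall x, partial_int F_ density_component A k x = 0%E}.
Proof.
(* There are finitely many J, so almost every x has all its averages finite; the cancellation is
   then pointwise in x. *)
move=> kA; apply: filterS (ae_average_fin_num mG G0 Gi) => x xfin.
pose a J t := (fine (average F_ G J (subst_coord k t x)))%:E.
rewrite /partial_int.
under eq_integral do rewrite density_component_coords -sumEFin.
rewrite (_ : (fun t => _) = fun t => (\sum_(J : {set 'I_n} | J \subset A)
    ((-1) ^+ (#|A| - #|J|))%:E * a J t)%E); last first.
  by apply/funext => t; apply: eq_bigr => J _; rewrite EFinM.
have aE J := integral_fine_average_subst (xfin J) (xfin (J :\ k)%SET).
rewrite integral_sum//; last first.
  by move=> J; apply: integrableZl => //; exact: (aE J).1.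
under eq_bigr => J JA.
  rewrite integralZl//; last exact: (aE J).1.
  rewrite (aE J).2 -EFinM signr_subset// -mulrA.
over.
rewrite sumEFin -mulr_sumr.
rewrite (alternating_sum_eq0 kA (c := fun J => fine (average F_ G (J :\ k)%SET x)))
  ?mulr0//.
move=> J; congr (fine (average _ _ _ _)); apply/setP => i.
by rewrite !inE; case: eqP.
Qed.

Hypothesis FF_ : has_marginals F_ F.

(** The one-dimensional marginal of F has the density [margin] with respect to dF_k, and also the
    density 1 because that marginal is F_k. Their difference integrates to 0 over every box. *)
Lemma average_set1 k : {ae mu, forall x, average F_ G [set k]%SET x = 1%E}.
Proof.
set J := [set k]%SET; set muJ := prodm (subfamily F_ (A := J)).
have mi := integrable_margin mG G0 Gi J.
have oi : muJ.-integrable setT (cst 1%E) by exact: finite_measure_integrable_cst.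
have d0 y : (\int[muJ]_(z in box y) (margin F_ G (J := J) \- cst 1%E) z = 0)%E.
  have my := measurable_box y.
  rewrite integralB//; [|exact: integrableS mi|exact: integrableS oi].
  rewrite integral_margin// -(marginal_cdfE y Gi FG).
  have -> : (\int[muJ]_(z in box y) cst 1 z = (F_ k (tnth (fill y 0%R) k))%:E)%E.
    rewrite integral_cst// mul1e.
    transitivity (prodm F_ (coords J @^-1` box y)); first exact/esym/(proj2 (has_law_coords F_ J)).
    by rewrite (coords_box y 0) prodm_cyl big_set1.
  rewrite /marginal_cdf.
  have := @FF_ k (tnth (fill y 0) k).
  rewrite (_ : (fun t : R => F _) = fun t => F (fill y t)); last first.
    apply/funext => t; rewrite [in RHS](fillE y 0); congr F.
    by apply: eq_mktuple => i; rewrite inE; case: eqP => [->|].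
  by move=> /(cvg_lim (@Rhausdorff R)) ->; rewrite subee.
have := ae_law (has_law_coords F_ J) (ae_box_eq0 (integrableB measurableT mi oi) d0).
apply: filterS => x H.
have : (margin F_ G (coords J x) - 1 = 0)%E by exact: H.
rewrite margin_coords.
case: (average F_ G J x) => [r| |]//=.
by rewrite -EFinB => -[] /eqP; rewrite subr_eq0 => /eqP ->.
Qed.

Hypothesis n0 : (0 < n)%N.

(** The integral of G is that of its average over a single coordinate, which is 1 almost everywhere;
    [n0] supplies a coordinate. *)
Lemma integral_density : (\int[mu]_x (G x)%:E = 1)%E.
Proof.
rewrite -(integral_average F_ mG G0 (J := [set Ordinal n0]%SET))//.
rewrite (ae_eq_integral (cst 1%E))//.
- by rewrite integral_cst// mul1e; exact: probability_setT.
- exact: measurable_average.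
- by apply: filterS (average_set1 (Ordinal n0)).
Qed.

(** Moebius inversion at the full index set writes G as the sum of all alternating sums. Those of
    size at most 1 must agree with [component]: the empty set gives the total mass 1, and a
    singleton gives 1 - 1 = 0. *)
Lemma U_sum_density_component :
  {ae mu, forall x, 1 + U_sum density_component x = G x}.
Proof.
have : {ae mu, forall x, forall k, average F_ G [set k]%SET x = 1%E}.
  by apply: filter_forall => k; exact: average_set1.
apply: filterS => x x1.
rewrite -partial_sumT -[RHS]/(fine (G x)%:E) -(average_setT F_ G).
rewrite -[RHS](moebius_sum (fun J => fine (average F_ G J x))).
apply: eq_bigr => A _; rewrite /component; case: ifPn => A2.
  by rewrite density_component_coords.
have a0 : fine (average F_ G finset.set0 x) = 1.
  by rewrite average_set0 integral_density.
case: (eqVneq A finset.set0) => [->|].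
  rewrite (big_pred1 finset.set0) => [|J]; last by rewrite finset.subset0.
  by rewrite cards0 mul1r a0.
rewrite -card_gt0 => A0; have /cards1P[k ->] : #|A| == 1%N.
  by rewrite eqn_leq A0 andbT -ltnS ltnNge.
rewrite (bigD1 finset.set0)/= ?finset.sub0set// (big_pred1 [set k]%SET) => [|J].
  by rewrite cards0 cards1 a0 x1 !mulr1 subnn addNr.
rewrite finset.subset1 /=; have [->|_] /= := eqVneq J [set k]%SET; last exact: andbN.
by rewrite -card_gt0 cards1.
Qed.

End family_of_density.

(** * Conditional expectations given some of the variables *)

Section sigma_algebra_of_coordinates.
Context d (T : measurableType d) (R : realType) (P : probability T R) (n : nat).
Variables (xi : 'I_n -> {RV P >-> R}).

(** The preimages under the random vector of Borel sets blind to coordinate k form a sigma-algebra,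
    and it contains the generators since k is not in J. *)
Lemma sigma_rv_preimage (J : {set 'I_n}) (k : 'I_n) (S : set T) :
  k \notin J -> sigma_rv xi J S ->
  exists E : set (n.-tuple R), [/\ measurable E, S = rvec xi @^-1` E &
    forall x t, E (subst_coord k t x) <-> E x].
Proof.
move=> kJ.
pose K := [set S : set T | exists E : set (n.-tuple R),
  [/\ measurable E, S = rvec xi @^-1` E &
    forall x t, E (subst_coord k t x) <-> E x]].
suff : sigma_rv xi J `<=` K by exact.
apply: smallest_sub.
  split => /=.
  - by exists set0; rewrite preimage_set0.
  - move=> _ [E [mE -> Ek]]; exists (~` E); split; first exact: measurableC.
      by rewrite setTD preimage_setC.
    by move=> x t /=; rewrite Ek.
  - move=> A /choice[E AE]; exists (\bigcup_i E i); split.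
    + by apply: bigcup_measurable => i _; have [] := AE i.
    + by rewrite preimage_bigcup; apply: eq_bigcupr => i _; have [] := AE i.
    + move=> x t; split=> -[i _ Ei]; exists i => //; have [_ _ Ek] := AE i.
        exact/(Ek x t).
      exact/(Ek x t).
move=> A [j /= jJ [B mB <-]]; exists ((@tnth n R ^~ j) @^-1` B); split.
- by rewrite -[X in measurable X]setTI; exact: measurable_tnth.
- by rewrite setTI; apply/seteqP; split => w /=; rewrite tnth_mktuple.
- move=> x t /=; rewrite subst_coord_out//.
  by apply: contraNneq kJ => <-.
Qed.

Variable F_ : 'I_n -> cdfType R.
Hypothesis xiF : has_law F_ P (rvec xi).

(** The averaging identity for the version 0 says that h(xi) integrates to 0 over the events
    generated by the variables in J. These are preimages of sets blind to k, so
    [integral_degenerate] applies after transfer to the product law. *)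
Lemma cond_exp_degenerate (h : n.-tuple R -> R) (J : {set 'I_n}) (k : 'I_n) :
  (prodm F_).-integrable setT (EFin \o h) -> k \notin J ->
  {ae prodm F_, forall x, \int[ls (F_ k)]_t (h (subst_coord k t x))%:E = 0%E}%E ->
  is_cond_exp P (fun w => h (rvec xi w)) (sigma_rv xi J) (cst 0).
Proof.
move=> hi kJ h0; split.
- move=> B _; have [S0 SC _] := smallest_sigma_algebra [set: T]
    (\bigcup_(j in [set j | j \in J]) preimage_set_system [set: T] (xi j) measurable).
  have [B0|B0] := pselect (B 0).
    rewrite (_ : _ @^-1` _ = [set: T] `\` set0); first exact: SC.
    by rewrite setD0; apply/seteqP; split.
  by rewrite (_ : _ @^-1` _ = set0)//; apply/seteqP; split.
- exact: integrable0.
- move=> A /(sigma_rv_preimage kJ)[E [mE -> Ek]].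
  rewrite integral0; apply/esym.
  have hEi : (prodm F_).-integrable setT ((EFin \o h) \_ E).
    by apply/(integrable_mkcond _ mE); exact: integrableS hi.
  rewrite -[RHS](integral_degenerate hi mE Ek h0).
  rewrite integral_mkcond [RHS]integral_mkcond (integral_law xiF hEi).
  apply: eq_integral => w _; rewrite !patchE.
  by congr (if _ then _ else _); apply/idP/idP; rewrite !inE.
Qed.

End sigma_algebra_of_coordinates.

(** * A nonnegative function of integral 1 as the density of a joint law *)

Section joint_cdf_of_density.
Context (R : realType) (n : nat) (mu : probability (n.-tuple R) R).
Variable V : n.-tuple R -> R.
Hypotheses (mV : measurable_fun setT V) (V0 : forall x, 0 <= V x)
  (V1 : (\int[mu]_x (V x)%:E = 1)%E).

Definition density_measure (A : set (n.-tuple R)) : \bar R :=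
  (\int[mu]_(x in A) (V x)%:E)%E.

Let density_measure0 : density_measure set0 = 0%E.
Proof. exact: integral_set0. Qed.

Let density_measure_ge0 A : (0 <= density_measure A)%E.
Proof. by apply: integral_ge0 => x _; rewrite lee_fin. Qed.

Let density_measure_sigma_additive : semi_sigma_additive density_measure.
Proof.
move=> A mA tA mUA; rewrite /density_measure ge0_integral_bigcup//.
- by apply: is_cvg_nneseries => k _ _; exact: density_measure_ge0.
- by apply/measurable_EFinP; exact: measurable_funTS.
- by move=> x _; rewrite lee_fin.
Qed.

HB.instance Definition _ := isMeasure.Build _ _ _ density_measure
  density_measure0 density_measure_ge0 density_measure_sigma_additive.

HB.instance Definition _ := Measure_isProbability.Build _ _ _ density_measure V1.

Lemma is_joint_cdf_density (F : n.-tuple R -> R) :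
  (forall x, (F x)%:E = \int[mu]_(z in box x) (V z)%:E)%E -> is_joint_cdf F.
Proof.
by move=> FV; exists [the probability _ _ of density_measure] => x; rewrite FV boxE.
Qed.

End joint_cdf_of_density.

(** * Both implications and uniqueness of the family *)

Section represented_cdf.
Context (R : realType) (n : nat) (F_ : 'I_n -> cdfType R).
Context d (T : measurableType d) (P : probability T R).
Variable xi : 'I_n -> {RV P >-> R}.
Hypothesis xiF : has_law F_ P (rvec xi).
Local Notation mu := (prodm F_).
Variable F : n.-tuple R -> R.

Lemma measurable_component_coords (g : forall A : {set 'I_n}, #|A|.-tuple R -> R)
    (A : {set 'I_n}) : borel_family g -> (2 <= #|A|)%N ->
  measurable_fun setT (fun x : n.-tuple R => g A (coords A x)).
Proof. by move=> mg A2; exact: (measurableT_comp (mg A A2) (@measurable_coords R n A)). Qed.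

Lemma cdf_intE (h : n.-tuple R -> R) x : mu.-integrable setT (EFin \o h) ->
  cdf_int F_ h x = (\int[mu]_(z in box x) (h z)%:E)%E.
Proof. by move=> hi; rewrite /cdf_int iter_intE. Qed.

Lemma ge0_cdf_intE m (H_ : 'I_m -> cdfType R) (h : m.-tuple R -> R) x :
  measurable_fun setT h -> (forall z, 0 <= h z) ->
  cdf_int H_ h x = (\int[prodm H_]_(z in box x) (h z)%:E)%E.
Proof.
move=> mh h0; rewrite /cdf_int ge0_iter_intE//; first exact/measurable_EFinP.
Qed.

Section from_family.
Variable g : forall A : {set 'I_n}, #|A|.-tuple R -> R.
Hypothesis gF : represents F_ xi g F.

Let mg : borel_family g. Proof. by case: gF. Qed.

Lemma represents_integrable (A : {set 'I_n}) : (2 <= #|A|)%N ->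
  mu.-integrable setT (fun x => (g (coords A x))%:E).
Proof.
move=> A2; have mgA := measurable_component_coords mg A2.
apply: (integrable_law_inv xiF); first exact/measurable_EFinP.
apply/integrableP; split.
  apply/measurable_EFinP; exact: (measurableT_comp mgA (proj1 xiF)).
by case: gF => _ /(_ A A2) + _ _ _; rewrite unlock.
Qed.

Lemma represents_degenerate (A : {set 'I_n}) (k : 'I_n) : (2 <= #|A|)%N -> k \in A ->
  {ae mu, forall x, partial_int F_ g A k x = 0%E}.
Proof.
move=> A2 kA.
have mp := measurable_partial_integral k (represents_integrable A2).
apply: (ae_law_inv (Q := [set x | partial_int F_ g A k x = 0%E]) xiF).
  by rewrite -[X in measurable X]setTI; exact: (mp measurableT [set 0%E] (emeasurable_set1 0%E)).
by case: gF => _ _ /(_ A k A2 kA)[Z [_ _ ?]] _ _.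
Qed.

Local Notation gi := represents_integrable.
Local Notation g0 := represents_degenerate.

Lemma integrable_1U : mu.-integrable setT (EFin \o (fun x => 1 + U_sum g x)).
Proof.
apply: eq_integrable (integrable_partial_sum gi finset.setT) => // x _ /=.
by rewrite partial_sumT.
Qed.

Let mU : measurable_fun setT (fun x => 1 + U_sum g x).
Proof. by apply/measurable_EFinP; exact: measurable_int integrable_1U. Qed.

Lemma represents_ge0 : {ae mu, forall x, 0 <= 1 + U_sum g x}.
Proof.
apply: (ae_law_inv (Q := [set x | 0 <= 1 + U_sum g x]) xiF).
  rewrite -[X in measurable X]setTI.
  rewrite (_ : [set x | _] = (fun x => 1 + U_sum g x) @^-1` `[0, +oo[%classic).
    exact: mU.
  by apply/seteqP; split => x /=; rewrite in_itv/= andbT.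
case: gF => _ _ _ + _; apply: filterS => w.
by rewrite /= -lerBlDl sub0r.
Qed.

Lemma representsE x : (F x)%:E = (\int[mu]_(z in box x) (1 + U_sum g z)%:E)%E.
Proof. by case: gF => _ _ _ _ ->; rewrite cdf_intE//; exact: integrable_1U. Qed.

(* 1 + U_n is nonnegative only almost everywhere. *)
Definition truncated_density (x : n.-tuple R) : R := Num.max 0 (1 + U_sum g x).

Lemma truncated_density_ge0 x : 0 <= truncated_density x.
Proof. by rewrite /truncated_density le_max lexx. Qed.

Lemma measurable_truncated_density : measurable_fun setT truncated_density.
Proof. exact: measurable_maxr. Qed.

Lemma ae_truncated_density : {ae mu, forall x, truncated_density x = 1 + U_sum g x}.
Proof.
by apply: filterS represents_ge0 => x x0; rewrite /truncated_density max_r.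
Qed.

Lemma integral_truncated_density E : measurable E ->
  (\int[mu]_(z in E) (truncated_density z)%:E =
   \int[mu]_(z in E) (1 + U_sum g z)%:E)%E.
Proof.
move=> mE; apply: ae_eq_integral => //.
- by apply/measurable_EFinP; apply: measurable_funTS; exact: measurable_truncated_density.
- by apply/measurable_EFinP; exact: measurable_funTS.
- by apply: filterS ae_truncated_density => x -> _.
Qed.

Lemma truncated_densityE x :
  (F x)%:E = (\int[mu]_(z in box x) (truncated_density z)%:E)%E.
Proof.
by rewrite integral_truncated_density ?representsE//; exact: measurable_box.
Qed.

(** Components start at size 2, so the partial sum over such a J is 1. The empty J gives the total
    mass 1, and a singleton J gives the marginal cdf's. *)
Lemma integral_1U_small (J : {set 'I_n}) b : (#|J| < 2)%N ->
  (\int[mu]_(x in cyl J b) (1 + U_sum g x)%:E = mu (cyl J b))%E.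
Proof.
move=> J2; have mJ := measurable_cyl J b.
rewrite (integral_partial_sumT gi g0 (J := J))//; last first.
  move=> k x t kJ; split => xb i iJ; have := xb i iJ; rewrite subst_coord_out//;
    by apply: contraNneq kJ => <-.
under eq_integral do rewrite partial_sum_small//.
by rewrite integral_cst// mul1e.
Qed.

Lemma represents_joint_cdf : is_joint_cdf F.
Proof.
apply: (is_joint_cdf_density measurable_truncated_density truncated_density_ge0 _
  truncated_densityE).
have := integral_1U_small [tuple 0 | i < n] (J := finset.set0).
rewrite (_ : cyl _ _ = setT); last by apply/seteqP; split => // x _ i; rewrite inE.
rewrite cards0 integral_truncated_density// => -> //.
exact: probability_setT.
Qed.

Lemma represents_marginals : has_marginals F_ F.
Proof.
move=> k r.
have := cvg_box_function integrable_1U (J := [set k]%SET) (b := [tuple r | i < n]) representsE.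
have -> : fine (\int[mu]_(y in cyl [set k]%SET [tuple r | i < n]) (1 + U_sum g y)%:E)%E = F_ k r.
  by rewrite integral_1U_small ?cards1// prodm_cyl big_set1 tnth_mktuple.
rewrite (_ : (fun t => F _) = fun t => F [tuple if i == k then r else t | i < n])//.
apply/funext => t; congr F; apply: eq_mktuple => i.
by rewrite inE tnth_mktuple.
Qed.

Lemma represents_abs_continuous : abs_continuous F_ F.
Proof.
exists truncated_density; split.
- exact: measurable_truncated_density.
- exact: truncated_density_ge0.
- move=> x; rewrite ge0_cdf_intE.
  + exact: truncated_densityE.
  + exact: measurable_truncated_density.
  + exact: truncated_density_ge0.
Qed.

Lemma represents_marginal_density (J : {set 'I_n}) :
  exists G : #|J|.-tuple R -> R, is_marginal_density F_ F G.
Proof.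
apply: (marginal_density_exists _ measurable_truncated_density truncated_density_ge0 _
  truncated_densityE).
apply/integrableP; split; first by apply/measurable_EFinP; exact: measurable_truncated_density.
have /integrableP[_] := integrable_1U; apply: le_lt_trans.
apply: ge0_le_integral => //=.
- apply/measurable_EFinP; apply: measurableT_comp => //; exact: measurable_truncated_density.
- by apply/measurable_EFinP; apply: measurableT_comp.
- move=> x _; rewrite lee_fin ger0_norm ?truncated_density_ge0//.
  by rewrite /truncated_density ge_max normr_ge0 ler_norm.
Qed.

Lemma represents_unique (dens : forall J : {set 'I_n}, #|J|.-tuple R -> R) :
  (forall x, F x <= 1) ->
  (forall J : {set 'I_n}, (2 <= #|J|)%N -> is_marginal_density F_ F (dens J)) ->
  forall A : {set 'I_n}, (2 <= #|A|)%N ->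
    {ae P, forall w, g (coords A (rvec xi w)) = f_incl_excl dens A (rvec xi w)}.
Proof.
move=> F1 densF A A2; apply: (ae_law xiF (Q := fun x => g (coords A x) = f_incl_excl dens A x)).
have : {ae mu, forall x, forall J : {set 'I_n}, (2 <= #|J|)%N ->
    dens J (coords J x) = partial_sum g J x}.
  apply: filter_forall => J; have [J2|J2] := leqP 2 #|J|; last exact: aeW.
  have := marginal_density_unique gi g0 F1 representsE (densF J J2).1.
  by apply: filterS => x ->.
apply: filterS => x densx.
have -> : g (coords A x) = component g A x by rewrite /component A2.
rewrite f_incl_exclE -(moebius_inversion (fun J => component g J x)).
under eq_bigr => J _ do rewrite -/(partial_sum g J x).
have [k kA] : exists k, k \in A by apply/card_gt0P; exact: leq_trans A2.
(* The alternating sum of a constant over the subsets of a nonempty A vanishes, so 1 may be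
   subtracted from each partial sum. The sets J with fewer than two elements then contribute 0,
   which leaves the range of summation of [f_incl_excl]. *)
have S0 : \sum_(J : {set 'I_n} | J \subset A) (-1) ^+ (#|A| - #|J|) * 1 = 0 :> R.
  under eq_bigr => J JA do rewrite signr_subset// -mulrA.
  by rewrite -mulr_sumr (alternating_sum_eq0 kA (c := fun=> 1)) ?mulr0.
transitivity (\sum_(J : {set 'I_n} | J \subset A)
    (-1) ^+ (#|A| - #|J|) * (partial_sum g J x - 1)).
  by under [RHS]eq_bigr do rewrite mulrBr; rewrite sumrB S0 subr0.
rewrite [RHS]big_mkcondr/=; apply: eq_bigr => J JA.
case: ifPn => J2; first by rewrite densx.
by rewrite partial_sum_small ?subrr ?mulr0// ltnNge.
Qed.

End from_family.

Lemma represents_exists : (0 < n)%N -> (forall x, F x <= 1) ->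
  has_marginals F_ F -> abs_continuous F_ F ->
  exists g : forall A : {set 'I_n}, #|A|.-tuple R -> R, represents F_ xi g F.
Proof.
move=> n0 F1 FF_ [G [mG G0 FG]].
have {}FG x : (F x)%:E = (\int[mu]_(z in box x) (G z)%:E)%E.
  by rewrite FG ge0_cdf_intE.
pose g := density_component F_ G.
have gi := integrable_density_component F1 mG G0 FG.
have UG := U_sum_density_component F1 mG G0 FG FF_ n0.
exists g; split.
- by move=> A _; exact: measurable_density_component.
- move=> A A2; rewrite unlock.
  by have /integrableP[_] := integrable_law xiF (gi A).
- move=> A k A2 kA; exists (cst 0).
  have g0 := degenerate_density_component F1 mG G0 FG kA.
  have g0P := ae_law xiF g0.
  split => //; last by apply: filterS g0P => w ->.
  apply: (cond_exp_degenerate xiF (h := fun x => g A (coords A x)) (k := k)) => //.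
    exact: gi.
  by rewrite !inE eqxx.
- apply: filterS (ae_law xiF UG) => w Uw.
  by rewrite -subr_ge0 opprK addrC [X in 0 <= X]Uw.
- have Ui : mu.-integrable setT (EFin \o (fun x => 1 + U_sum g x)).
    apply: eq_integrable (integrable_partial_sum (fun A _ => gi A) finset.setT) => // x _ /=.
    by rewrite partial_sumT.
  move=> x; rewrite FG cdf_intE//; apply: ae_eq_integral.
  + exact: measurable_box.
  + by apply/measurable_EFinP; exact: measurable_funTS.
  + by apply: measurable_funTS; exact: measurable_int Ui.
  + by apply: filterS UG => z Uz _; rewrite -[in LHS]Uz.
Qed.

End represented_cdf.

Theorem theorem2p1 (R : realType) (n : nat) (hn : (2 <= n)%N)
    (F_ : 'I_n -> cdfType R)
    (d : measure_display) (T : measurableType d) (P : probability T R)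
    (xi : 'I_n -> {RV P >-> R})
    (hindep : mutually_independent xi)
    (hcdf : forall (k : 'I_n) (x : R), cdf (xi k) x = (F_ k x)%:E)
    (F : n.-tuple R -> R)
    (hF01 : forall x, 0 <= F x <= 1) :
  ([/\ is_joint_cdf F, has_marginals F_ F & abs_continuous F_ F] <->
   exists g : forall A : {set 'I_n}, #|A|.-tuple R -> R,
     represents F_ xi g F) /\
  (forall g : forall A : {set 'I_n}, #|A|.-tuple R -> R,
     represents F_ xi g F ->
     (forall J : {set 'I_n}, (2 <= #|J|)%N ->
        exists G : #|J|.-tuple R -> R, is_marginal_density F_ F G) /\
     (forall dens : forall J : {set 'I_n}, #|J|.-tuple R -> R,
        (forall J : {set 'I_n}, (2 <= #|J|)%N ->
           is_marginal_density F_ F (dens J)) ->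
        forall A : {set 'I_n}, (2 <= #|A|)%N ->
          {ae P, forall w, g A (coords A (rvec xi w)) =
                           f_incl_excl dens A (rvec xi w)})).
Proof.
have xiF := has_law_rvec hindep hcdf.
have F1 x : F x <= 1 by have /andP[] := hF01 x.
split; first split.
- by move=> [_ FF_ FG]; apply: (represents_exists xiF) => //; exact: ltnW.
- move=> [g gF]; split.
  + exact: represents_joint_cdf gF.
  + exact: represents_marginals gF.
  + exact: represents_abs_continuous gF.
- move=> g gF; split.
  + by move=> J _; exact: represents_marginal_density gF J.
  + move=> dens densF; exact: represents_unique gF dens F1 densF.
Qed.
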